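(* Let $\mathcal G$ be a basic arc diagram on $\{1,\dots,N\}$, and suppose that $\mathcal G$ is decomposable at $N'\in\{1,\dots,N-1\}$. Then $$\mathcal G^{\mathsf A}=\mathcal G_{N'+1,N}^{\mathsf A}\bowtie\mathcal G_{1,N'}^{\mathsf A}.$$ In other words, H-dual acts on a basic diagram by respectively dualizing the two components obtained by removing the arc $(N,N')$, reversing their order, and gluing them back together.
   Context: Algorithms. Let $N\ge 1$ be an integer. An H-matrix of size $N-1$ is a real lower triangular matrix $H=(h_{k,j})_{1\le j\le k\le N-1}$ (empty for $N=1$). Given a real Hilbert space $\mathcal X$, an operator $T:\mathcal X\to\mathcal X$ and $y_0\in\mathcal X$, the algorithm defined by $H$ generates $y_{k+1}=y_k-\sum_{j=0}^{k}h_{k+1,j+1}(y_j-Ty_j)$ for $k=0,\dots,N-2$. $T$ is nonexpansive if $\|Tx-Ty\|\le\|x-y\|$ for all $x,y\in\mathcal X$; $y_\star$ is a fixed point if $Ty_\star=y_\star$. $\mathcal H_\star(N-1)$ is the set of H-matrices of size $N-1$ such that $\|y_{N-1}-Ty_{N-1}\|^2\le 4\|y_0-y_\star\|^2/N^2$ for every real Hilbert space $\mathcal X$, every nonexpansive $T:\mathcal X\to\mathcal X$ with a fixed point $y_\star$ and every $y_0\in\mathcal X$. The H-dual of $H$ is the anti-diagonal transpose $H^{\mathsf A}$ with $(H^{\mathsf A})_{k,j}=h_{N-j,N-k}$, $1\le j\le k\le N-1$. H-certificates. For $m,j\in\{1,\dots,N-1\}$ let $Q(m,j;H)=\sum\prod_{r=1}^m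 h_{i(r),j(r)}$, the sum over all integers $j=j(1)\le i(1)<j(2)\le i(2)<\cdots<j(m)\le i(m)\le N-1$ (an empty sum is $0$). The H-certificates of $H$ are $\lambda^\star_{N,j}(H)=N\sum_{m=1}^{N-1}(-1)^{m-1}Q(m,j;H)$ for $1\le j\le N-1$, and $\lambda^\star_{k,j}(H)=N\sum_{\ell=1}^{N-1}\sum_{m=1}^{N-1}(-1)^{\ell+m-1}\binom{\ell+m}{m}Q(\ell,j;H)Q(m,k;H)$ for $1\le j<k\le N-1$. Known fact (Yoon–Ryu–Grimmer): $H\in\mathcal H_\star(N-1)$ if and only if $\sum_{j=1}^{N-1}Q(k,j;H)=\frac1N\binom{N}{k+1}$ for $k=1,\dots,N-1$ and $\lambda^\star_{k,j}(H)\ge 0$ for all $1\le j<k\le N$. Vertices and arc diagrams. A vertex of $\mathcal H_\star(N-1)$ is an $H\in\mathcal H_\star(N-1)$ such that for each $j=1,\dots,N-1$ there is exactly one index $k(j)\in\{j+1,\dots,N\}$ with $\lambda^\star_{k(j),j}(H)>0$. An arc diagram on nodes $\{1,\dots,N\}$ is a graph with edge (arc) set $\{(k(j),j):1\le j\le N-1\}$ for some integers $j<k(j)\le N$. The arc diagram $\mathcal G(H)$ of a vertex $H$ is the one given by its indices $k(j)$; every arc diagram is $\mathcal G(H)$ for a unique vertex $H$. Gluing. For arc diagrams $\mathcal G_1$ on $N_1$ nodes and $\mathcal G_2$ on $N_2$ nodes, $\mathcal G_1\bowtie\mathcal G_2$ is the arc diagram on $N_1+N_2$ nodes obtained by relabeling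 the nodes of $\mathcal G_2$ as $N_1+1,\dots,N_1+N_2$ and adding the arc $(N_1+N_2,N_1)$. Basic arc diagrams are defined recursively: the single-node diagram is basic, and a diagram is basic if it is a gluing of smaller basic diagrams; equivalently, the diagram is non-crossing (no $j_1<j_2<k(j_1)<k(j_2)$). Decomposability. $\mathcal G$ is decomposable at $N'$ if $k(N')=N$ and $k(j)\le N'$ for all $j=1,\dots,N'-1$. Removing the arc $(N,N')$ then separates $\mathcal G$ into $\mathcal G_{1,N'}$ (on nodes $1,\dots,N'$) and $\mathcal G_{N'+1,N}$ (on nodes $N'+1,\dots,N$, relabeled $1,\dots,N-N'$), so $\mathcal G=\mathcal G_{1,N'}\bowtie\mathcal G_{N'+1,N}$. Dual diagram. For a basic arc diagram $\mathcal G=\mathcal G(H)$ with $H$ the corresponding vertex, $H^{\mathsf A}$ is again a vertex of $\mathcal H_\star(N-1)$, and $\mathcal G^{\mathsf A}:=\mathcal G(H^{\mathsf A})$. *)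

(* Defs.v *)
From HB Require Import structures.
From mathcomp Require Import all_boot all_order all_algebra.
From mathcomp Require Import all_classical all_reals all_analysis.

Set Implicit Arguments.
Unset Strict Implicit.
Unset Printing Implicit Defensive.

Import Order.TTheory GRing.Theory Num.Theory.
Import numFieldNormedType.Exports.

Local Open Scope ring_scope.
Local Open Scope classical_set_scope.

(* Throughout, n = N - 1: an H-matrix of size N - 1 is a lower triangular
   H : 'M[R]_n, whose 0-based entry H k j is the 1-based h_{k+1,j+1}. *)

Definition nonexpansive (R : realType) (X : normedModType R) (T : X -> X) :=
  forall x y : X, `|T x - T y| <= `|x - y|.

Definition generates (R : realType) (X : normedModType R) n (H : 'M[R]_n)
    (T : X -> X) (y : nat -> X) :=
  forall k : 'I_n,
    y k.+1 = y k - \sum_(j < n | (j <= k)%N) H k j *: (y j - T (y j)).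

(* A real Hilbert space is a complete normed module whose norm comes from a
   positive definite symmetric bilinear form. *)
Definition Hstar (R : realType) n (H : 'M[R]_n) : Prop :=
  is_trig_mx H /\
  forall (X : completeNormedModType R) (dot : {dot X for idfun}),
    (forall x : X, dot x x = `|x| ^+ 2) ->
    forall (T : X -> X) (ystar : X) (y : nat -> X),
      nonexpansive T -> T ystar = ystar -> generates H T y ->
      `|y n - T (y n)| ^+ 2 <= 4 * `|y 0%N - ystar| ^+ 2 / n.+1%:R ^+ 2.

(* (H^A)_{k,j} = h_{N-j,N-k} in 1-based indices. *)
Definition Hdual (R : realType) n (H : 'M[R]_n) : 'M[R]_n :=
  \matrix_(k, j) H (rev_ord j) (rev_ord k).

(* The list of pairs (i(r), j(r)), r = 1..m, satisfies
   j = j(1) <= i(1) < j(2) <= i(2) < ... < j(m) <= i(m), where j is 1-based. *)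
Definition index_chain n (j : nat) (c : seq ('I_n * 'I_n)) : bool :=
  [&& ohead [seq (nat_of_ord p.2).+1 | p : 'I_n * 'I_n <- c] == Some j,
      all (fun p : 'I_n * 'I_n => p.2 <= p.1)%N c
    & sorted (fun p q : 'I_n * 'I_n => p.1 < q.2)%N c].

Definition Qsum (R : realType) n (H : 'M[R]_n) (m j : nat) : R :=
  \sum_(c : m.-tuple ('I_n * 'I_n) | index_chain j c) \prod_(p <- c) H p.1 p.2.

(* lambda^*_{k,j}(H), with 1-based k and j. *)
Definition certificate (R : realType) n (H : 'M[R]_n) (k j : nat) : R :=
  if k == n.+1 then
    n.+1%:R * \sum_(1 <= m < n.+1) (-1) ^+ m.-1 * Qsum H m j
  else
    n.+1%:R * \sum_(1 <= l < n.+1) \sum_(1 <= m < n.+1)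
      (-1) ^+ (l + m).-1 * 'C(l + m, m)%:R * Qsum H l j * Qsum H m k.

Definition vertex (R : realType) n (H : 'M[R]_n) : Prop :=
  Hstar H /\
  forall j : nat, (1 <= j <= n)%N ->
    exists! k : nat, (j < k <= n.+1)%N /\ 0 < certificate H k j.

(* The arc diagram on {1, ..., N} with arcs (k(j), j) is encoded as the list
   [:: k(1); ...; k(N-1)]; thus N = (size G).+1. *)
Definition arc_end (G : seq nat) (j : nat) : nat := nth 0%N G j.-1.

Definition arc_diagram (N : nat) (G : seq nat) : Prop :=
  N = (size G).+1 /\
  forall j : nat, (1 <= j < N)%N -> (j < arc_end G j <= N)%N.

(* For a vertex H the filtered list is the singleton [:: k(j)]. *)
Definition diagram_of (R : realType) n (H : 'M[R]_n) : seq nat :=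
  [seq head 0%N [seq k <- iota j.+1 (n.+1 - j) | 0 < certificate H k j]
     | j <- iota 1 n].

Definition gluing (G1 G2 : seq nat) : seq nat :=
  let N1 := (size G1).+1 in let N2 := (size G2).+1 in
  G1 ++ (N1 + N2)%N :: [seq (N1 + k)%N | k <- G2].

Inductive basic : seq nat -> Prop :=
| basic_single : basic [::]
| basic_gluing G1 G2 : basic G1 -> basic G2 -> basic (gluing G1 G2).

Definition decomposable_at (G : seq nat) (N' : nat) : Prop :=
  arc_end G N' = (size G).+1 /\
  forall j : nat, (1 <= j < N')%N -> (arc_end G j <= N')%N.

(* G_{1,N'} keeps the arcs of the nodes 1..N'-1; G_{N'+1,N} keeps those of the
   nodes N'+1..N-1, relabeled by subtracting N'. *)
Definition left_part (G : seq nat) (N' : nat) : seq nat := take N'.-1 G.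

Definition right_part (G : seq nat) (N' : nat) : seq nat :=
  [seq (k - N')%N | k <- drop N' G].

(* The vertex with diagram G; it is unique for every arc diagram G, so the
   default value 0 is irrelevant. *)
Definition vertex_of (R : realType) (G : seq nat) : 'M[R]_(size G) :=
  xget 0 [set H : 'M[R]_(size G) | vertex H /\ diagram_of H = G].

Definition dual_diagram (R : realType) (G : seq nat) : seq nat :=
  diagram_of (Hdual (vertex_of R G)).

(* Main.v *)
(* Encode the Q-sums of H by the polynomials q_j = \sum_m Q(m,j) (X - 1)^m
   (q_N = 1), where X stands for the operator T.  By Vandermonde's identity the
   H-certificates are -N times the coefficient dot products of the q_j, and the
   Q-sum condition says that \sum_j q_j = (1 + X + ... + X^(N-1)) / N.

   Under this condition N times the Gram matrix of the q_j is the Laplacian of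
   the certificates plus a unit entry at N, and summation by parts along the
   iterates gives
     \sum_(j < k) lambda_kj I_kj + I_N* = 2 <y_0, g_N> - N |g_N|^2
   with g = y - T y and I the nonexpansiveness slacks; so nonnegative
   certificates suffice for optimality.  Conversely, running H on the isometry
   of R^N with T^N = -1, started at (1, ..., 1), forces the Q-sum condition, and
   small perturbations of this isometry in one direction force every certificate
   to be nonnegative.

   For vertices H1, H2 with diagrams G1, G2, the block matrix
     [ H1               0         0  ]
     [ -(N2/N) 1^T H1   N1 N2/N   0  ]
     [ 0        -(N1/N) H2 1      H2 ]
   is a vertex with diagram G1 >< G2, and orthogonality of the q_j shows by
   induction that a basic diagram determines its vertex.  The anti-diagonal
   transpose of this block matrix is the one built from H2^A and H1^A. *)
From HB Require Import structures.
Require Import Defs.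
From mathcomp Require Import all_boot all_order all_algebra.
From mathcomp Require Import all_classical all_reals all_analysis.
From mathcomp Require Import ring lra zify.
Set Implicit Arguments.
Unset Strict Implicit.
Unset Printing Implicit Defensive.
Import Order.TTheory GRing.Theory Num.Theory.
Import numFieldNormedType.Exports.
Local Open Scope ring_scope.

(** * Euclidean space as a Hilbert space *)

Section DotTheory.
Variables (R : realType) (X : lmodType R) (dot : {dot X for idfun}).

Lemma dotC x y : dot x y = dot y x.
Proof. by rewrite hermitian_subproof expr0 mul1r. Qed.

Lemma dotDl x y z : dot (x + y) z = dot x z + dot y z. Proof. exact: linearDl. Qed.
Lemma dotDr x y z : dot z (x + y) = dot z x + dot z y. Proof. exact: linearDr. Qed.
Lemma dotNl x z : dot (- x) z = - dot x z. Proof. exact: linearNl. Qed.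
Lemma dotNr x z : dot z (- x) = - dot z x. Proof. exact: linearNr. Qed.
Lemma dotBr x y z : dot z (x - y) = dot z x - dot z y. Proof. exact: linearBr. Qed.
Lemma dotZl a x z : dot (a *: x) z = a * dot x z. Proof. exact: linearZl_LR. Qed.
Lemma dotZr a x z : dot z (a *: x) = a * dot z x. Proof. exact: linearZr_LR. Qed.
Lemma dot0l z : dot 0 z = 0. Proof. exact: linear0l. Qed.
Lemma dot0r z : dot z 0 = 0. Proof. exact: linear0r. Qed.

Lemma dot_suml I (r : seq I) (P : pred I) E z :
  dot (\sum_(i <- r | P i) E i) z = \sum_(i <- r | P i) dot (E i) z.
Proof. exact: linear_sumlz. Qed.

Lemma dot_sumr I (r : seq I) (P : pred I) E z :
  dot z (\sum_(i <- r | P i) E i) = \sum_(i <- r | P i) dot z (E i).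
Proof. exact: linear_sumr. Qed.

Definition dotE := (dotDl, dotDr, dotNl, dotNr, dotZl, dotZr, dot0l, dot0r).

Lemma dot_ge0 x : 0 <= dot x x.
Proof.
have [->|x0] := eqVneq x 0; first by rewrite dot0l.
by apply: ltW; apply: neq0_dnorm_gt0.
Qed.

Lemma dot_eq0 x : dot x x = 0 -> x = 0.
Proof.
move=> d0; apply/eqP; apply: contraT => /(@neq0_dnorm_gt0 _ _ _ dot).
by rewrite d0 ltxx.
Qed.

Lemma Cauchy_Schwarz x y : dot x y ^+ 2 <= dot x x * dot y y.
Proof.
have [->|x0] := eqVneq x 0; first by rewrite !dot0l expr0n mul0r.
have dx : 0 < dot x x by exact: neq0_dnorm_gt0.
have := dot_ge0 (dot x x *: y - dot x y *: x).
rewrite !dotE (dotC y x) => h.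
rewrite -subr_ge0 -(pmulr_rge0 _ dx); apply: le_trans h _.
rewrite le_eqVlt; apply/orP; left; apply/eqP; ring.
Qed.

Lemma dot_distZ x z a : dot (x - a *: z) (x - a *: z) =
  dot x x - 2 * a * dot z x + a ^+ 2 * dot z z.
Proof. by rewrite !dotE (dotC x z); ring. Qed.

End DotTheory.

Section Euclid.
Variables (R : realType) (n : nat).

(** A separate alias, because row vectors already carry the max norm, while [Hstar] needs a norm
    that comes from an inner product. *)
Definition euclid : Type := 'rV[R]_n.
HB.instance Definition _ := GRing.Lmodule.on euclid.

Definition ecoord (x : euclid) (i : 'I_n) : R := fun_of_matrix x 0 i.

Lemma ecoordD x y i : ecoord (x + y) i = ecoord x i + ecoord y i.
Proof. exact: mxE. Qed.

Lemma ecoordZ a x i : ecoord (a *: x) i = a * ecoord x i.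
Proof. exact: mxE. Qed.

Lemma ecoordN x i : ecoord (- x) i = - ecoord x i.
Proof. exact: mxE. Qed.

Definition edot (x y : euclid) : R := \sum_i ecoord x i * ecoord y i.

Lemma edotC x y : edot x y = edot y x.
Proof. by apply: eq_bigr => i _; rewrite mulrC. Qed.

Lemma edotDZl y a (u v : euclid) : edot (a *: u + v) y = a * edot u y + edot v y.
Proof.
rewrite /edot mulr_sumr -big_split; apply: eq_bigr => i _.
by rewrite ecoordD ecoordZ mulrDl mulrA.
Qed.

Lemma edot_ge0 x : 0 <= edot x x.
Proof. by apply: sumr_ge0 => i _; rewrite -expr2 sqr_ge0. Qed.

Lemma edot_sqr_le x i : ecoord x i ^+ 2 <= edot x x.
Proof.
rewrite /edot (bigD1 i) //= -expr2 lerDl.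
by apply: sumr_ge0 => j _; rewrite -expr2 sqr_ge0.
Qed.

Lemma edot_gt0 x : x != 0 -> 0 < edot x x.
Proof.
move=> x0; rewrite lt_neqAle edot_ge0 andbT eq_sym; apply: contra x0 => /eqP d0.
apply/eqP/rowP => i; rewrite [RHS]mxE; apply/eqP; rewrite -sqrf_eq0 eq_le sqr_ge0 andbT.
by rewrite -d0 edot_sqr_le.
Qed.

Fact edot_linearl y : linear_for *%R (edot ^~ y).
Proof. by move=> a u v; exact: edotDZl. Qed.

Fact edot_linearr x : linear_for (idfun \; *%R) (edot x).
Proof. by move=> a u v; rewrite ![edot x _]edotC edotDZl. Qed.

HB.instance Definition _ := bilinear_isBilinear.Build R euclid euclid R _ _ edot
  (conj edot_linearl edot_linearr).
HB.instance Definition _ := isHermitianSesquilinear.Build R euclid false idfun edot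
  (fun x y => etrans (edotC x y) (esym (mul1r _))).
HB.instance Definition _ := isDotProduct.Build R euclid edot edot_gt0.

Lemma edotDr x y z : edot z (x + y) = edot z x + edot z y. Proof. exact: (dotDr edot). Qed.
Lemma edotNr x z : edot z (- x) = - edot z x. Proof. exact: (dotNr edot). Qed.
Lemma edotBr x y z : edot z (x - y) = edot z x - edot z y. Proof. exact: (dotBr edot). Qed.
Lemma edotZr a x z : edot z (a *: x) = a * edot z x. Proof. exact: (dotZr edot). Qed.

Lemma edot_sumr I (r : seq I) (P : pred I) (F : I -> euclid) z :
  edot z (\sum_(i <- r | P i) F i) = \sum_(i <- r | P i) edot z (F i).
Proof. exact: (dot_sumr edot). Qed.

Lemma edot0r z : edot z 0 = 0. Proof. exact: (dot0r edot). Qed.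
Lemma edot_distZ x z a : edot (x - a *: z) (x - a *: z) =
  edot x x - 2 * a * edot z x + a ^+ 2 * edot z z.
Proof. exact: (dot_distZ edot). Qed.

Definition enorm (x : euclid) : R := Num.sqrt (edot x x).

Fact enormZ a x : enorm (a *: x) = `|a| * enorm x.
Proof.
rewrite /enorm !dotE mulrA -expr2 sqrtrM ?sqr_ge0 //.
by rewrite sqrtr_sqr.
Qed.

Fact enorm0_eq0 x : enorm x = 0 -> x = 0.
Proof.
move=> /eqP; rewrite sqrtr_eq0 => d0; apply/eqP; apply: contraT => /edot_gt0.
by rewrite ltNge d0.
Qed.

Fact ler_enormD x y : enorm (x + y) <= enorm x + enorm y.
Proof.
have CS : edot x y <= enorm x * enorm y.
  rewrite -sqrtrM ?edot_ge0 // (le_trans (ler_norm _)) // -sqrtr_sqr ler_wsqrtr //.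
  exact: (Cauchy_Schwarz edot).
rewrite -(@ler_pXn2r _ 2) ?nnegrE ?addr_ge0 ?sqrtr_ge0 // sqrrD !sqr_sqrtr ?edot_ge0 //.
have -> : edot (x + y) (x + y) = edot x x + edot x y *+ 2 + edot y y.
  by rewrite !dotE (dotC _ y x) /=; ring.
by rewrite lerD2r lerD2l lerMn2r CS.
Qed.

HB.instance Definition _ := Lmodule_isNormed.Build R euclid ler_enormD enormZ enorm0_eq0.

Lemma edot_norm x : edot x x = `|x| ^+ 2.
Proof. by rewrite [`|x|]/(enorm x) sqr_sqrtr ?edot_ge0. Qed.

(** The filter is read again in the max norm, where completeness is known: coordinates are bounded
    by the Euclidean norm, so it is Cauchy there, and the limit is carried back. *)
Fact euclid_complete (F : set_system euclid) : ProperFilter F -> cauchy F -> cvg F.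
Proof.
move=> FF /cauchyP Fc.
pose G : set_system 'rV[R]_n := F.
have GF : ProperFilter G by exact: FF.
have Gc : cauchy G.
  apply: cauchy_exP => e e0; have [x Fx] := Fc e e0; exists x.
  apply: filterS Fx => y; rewrite -ball_normE /= => xy; split=> // i j; rewrite ord1.
  apply: le_lt_trans xy; rewrite -[leLHS](sqrtr_sqr) -[leRHS]/(enorm _) /enorm.
  apply: ler_wsqrtr; apply: le_trans (edot_sqr_le _ j).
  by rewrite ecoordD /ecoord !mxE.
have : cvg G by exact: cauchy_cvg.
move=> /cvg_ex[l Gl].
apply/cvg_ex; exists l; apply/cvg_ballP => e e0.
(* With this radius in each of the [n] coordinates the squared distance is at most
   [n (e / (n+1))^2 < e^2], also for [n = 0]. *)
have d0 : 0 < e / n.+1%:R by rewrite divr_gt0.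
have /cvg_ballP/(_ _ d0) := Gl.
apply: filterS => y [_ Gy]; rewrite -ball_normE /=.
rewrite -(@ltr_pXn2r _ 2) ?nnegrE ?normr_ge0 ?ltW // -edot_norm.
have le : edot (l - y) (l - y) <= \sum_(i < n) (e / n.+1%:R) ^+ 2.
  apply: ler_sum => i _; rewrite -expr2 -[leLHS]real_normK ?num_real //.
  rewrite ler_pXn2r ?nnegrE ?normr_ge0 // ?ltW //.
  by have := Gy 0 i; rewrite /ball /= /ecoord !mxE.
apply: le_lt_trans le _; rewrite sumr_const card_ord -(mulr_natl _ n) exprMn.
rewrite mulrCA gtr_pMr ?exprn_gt0 // exprVn ltr_pdivrMr ?exprn_gt0 // mul1r.
by rewrite -natrX ltr_nat; apply: leq_trans (ltnSn n) _; rewrite expnS leq_pmulr ?expn_gt0.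
Qed.
HB.instance Definition _ := Uniform_isComplete.Build euclid euclid_complete.
End Euclid.
(** * Coefficient dot product of polynomials *)

Section PolyDot.
Variable R : comNzRingType.
Implicit Types p q r : {poly R}.

Definition pdot p q : R := \sum_(t < size p) p`_t * q`_t.

Lemma pdot_wide n p q : (size p <= n)%N -> pdot p q = \sum_(t < n) p`_t * q`_t.
Proof.
move=> le_pn; rewrite /pdot -!(big_mkord xpredT (fun t => p`_t * q`_t)).
rewrite (big_cat_nat (leq0n _) le_pn) /= [X in _ + X]big1_seq ?addr0 //.
by move=> t /andP[_]; rewrite mem_index_iota => /andP[le_pt _]; rewrite nth_default ?mul0r.
Qed.

Lemma pdotC p q : pdot p q = pdot q p.
Proof.
rewrite (pdot_wide _ (leq_maxl (size p) (size q))).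
rewrite (pdot_wide _ (leq_maxr (size p) (size q))).
by apply: eq_bigr => t _; rewrite mulrC.
Qed.

Lemma pdotDr r p q : pdot r (p + q) = pdot r p + pdot r q.
Proof. by rewrite /pdot -big_split; apply: eq_bigr => t _; rewrite coefD mulrDr. Qed.

Lemma pdotZr r a p : pdot r (a *: p) = a * pdot r p.
Proof. by rewrite /pdot mulr_sumr; apply: eq_bigr => t _; rewrite coefZ mulrCA. Qed.

Lemma pdotBr r p q : pdot r (p - q) = pdot r p - pdot r q.
Proof. by rewrite -scaleN1r pdotDr pdotZr mulN1r. Qed.

Lemma pdot0r r : pdot r 0 = 0.
Proof. by rewrite -(subrr 0) pdotBr subrr. Qed.

Lemma pdotZl r a p : pdot (a *: p) r = a * pdot p r.
Proof. by rewrite !(pdotC _ r) pdotZr. Qed.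

Lemma pdotBl r p q : pdot (p - q) r = pdot p r - pdot q r.
Proof. by rewrite !(pdotC _ r) pdotBr. Qed.

Lemma pdot_sumr I (s : seq I) (P : pred I) F r :
  pdot r (\sum_(i <- s | P i) F i) = \sum_(i <- s | P i) pdot r (F i).
Proof. exact: (big_morph _ (pdotDr r) (pdot0r r)). Qed.

Lemma pdot_suml I (s : seq I) (P : pred I) F r :
  pdot (\sum_(i <- s | P i) F i) r = \sum_(i <- s | P i) pdot (F i) r.
Proof. by rewrite pdotC pdot_sumr; apply: eq_bigr => i _; rewrite pdotC. Qed.

Lemma pdot_mulXn n p q : pdot ('X^n * p) ('X^n * q) = pdot p q.
Proof.
rewrite (@pdot_wide (n + size p)) ?big_split_ord /=; last first.
  by rewrite mulrC (leq_trans (size_polyMleq _ _)) // size_polyXn addnC.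
rewrite big1 => [|t _]; last by rewrite coefXnM ltn_ord mul0r.
by rewrite add0r; apply: eq_bigr => t _; rewrite !coefXnM ltnNge leq_addr addKn.
Qed.

Lemma pdot_mulXn_small n p q : (size q <= n)%N -> pdot ('X^n * p) q = 0.
Proof.
move=> le_qn; rewrite pdotC /pdot big1 // => t _.
by rewrite coefXnM (leq_trans (ltn_ord t) le_qn) mulr0.
Qed.

Definition ones n : {poly R} := \sum_(t < n) 'X^t.

Lemma coef_ones n t : (ones n)`_t = (t < n)%:R.
Proof.
rewrite coef_sum; under eq_bigr do rewrite coefXn.
case: ltnP => [lt_tn|le_nt].
  rewrite (bigD1 (Ordinal lt_tn)) //= eqxx big1 ?addr0 // => i.
  by rewrite -val_eqE eq_sym /= => /negPf->.
by rewrite big1 // => i _; rewrite gtn_eqF // (leq_trans (ltn_ord i)).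
Qed.

Lemma size_ones n : (size (ones n) <= n)%N.
Proof. by apply/leq_sizeP => t le_nt; rewrite coef_ones ltnNge le_nt. Qed.

Lemma onesD n1 n2 : ones (n1 + n2) = ones n1 + 'X^n1 * ones n2.
Proof.
by rewrite /ones big_split_ord mulr_sumr; congr (_ + _); apply: eq_bigr => t _; rewrite -exprD.
Qed.

Lemma ones_sub n : (1 - 'X) * ones n = 1 - 'X^n.
Proof. by rewrite -(opprB 'X^n) subrX1 -mulNr opprB. Qed.

Lemma horner_ones n : (ones n).[1] = n%:R.
Proof.
rewrite horner_sum; under eq_bigr do rewrite hornerXn expr1n.
by rewrite sumr_const card_ord.
Qed.

Lemma pdot_ones n q : (size q <= n)%N -> pdot (ones n) q = q.[1].
Proof.
move=> le_qn; rewrite pdotC (pdot_wide _ le_qn) (horner_coef_wide _ le_qn).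
by apply: eq_bigr => t _; rewrite coef_ones ltn_ord expr1n.
Qed.

Lemma pdot1 q : pdot q 1 = q`_0.
Proof.
rewrite pdotC /pdot size_polyC oner_neq0 big_ord1 coef1 mul1r //.
Qed.

Lemma coef_expXsub1 l t : (('X - 1 : {poly R}) ^+ l)`_t = (-1) ^+ (l + t) *+ 'C(l, t).
Proof.
elim: l t => [|l IH] t.
  by rewrite expr0 coef1 bin0n; case: t => [|t]; rewrite ?mulr1n ?mulr0n.
rewrite exprSr mulrBr mulr1 coefB coefMX !IH; case: t => [|t] /=.
  by rewrite !bin0 !mulr1n sub0r addSn exprS mulN1r.
by rewrite addSn addnS !exprS !mulN1r opprK mulNrn opprK binS mulrnDr addrC.
Qed.

(** In every degree the two signs multiply to [(-1)^(l+m)], and Vandermonde sums the products of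
    binomials. This is the source of the binomial in [certificate]. *)
Lemma pdot_expXsub1 l m :
  pdot (('X - 1) ^+ l) (('X - 1) ^+ m) = (-1) ^+ (l + m) * 'C(l + m, m)%:R.
Proof.
have sz k : (size (('X - 1 : {poly R}) ^+ k) <= k.+1)%N.
  by rewrite -polyC1 size_exp_XsubC.
rewrite (pdot_wide _ (sz l)).
under eq_bigr => t _ do
  rewrite !coef_expXsub1 -mulr_natr -[X in _ * X]mulr_natr mulrACA -exprD
    addnACA exprD -(signr_odd _ (t + t)) oddD addbb mulr1 -natrM.
rewrite -mulr_sumr -natr_sum; congr (_ * _%:R).
rewrite -(bin_sub (leq_addl l m)) addnK.
rewrite [(l + m)%N]addnC -binomial.Vandermonde; apply: eq_bigr => t _.
by rewrite mulnC bin_sub // -ltnS.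
Qed.

End PolyDot.
(** * Response polynomials *)

Section Response.
Variable R : realType.

(** Extension by 0 to all natural indices, so that matrices of different sizes can be glued and
    compared without casts. *)
Definition entry n (H : 'M[R]_n) (i j : nat) : R :=
  if insub i is Some k then (if insub j is Some l then H k l else 0) else 0.

Lemma entryE n (H : 'M[R]_n) (i j : 'I_n) : entry H i j = H i j.
Proof. by rewrite /entry !valK. Qed.

(** The recursion splits off the first pair [(i, j)] of a chain: what follows is a chain starting at
    some [k > i], or nothing, which [q n = 1] accounts for. Indices are 0-based. *)
Definition is_response n (h : nat -> nat -> R) (q : nat -> {poly R}) : Prop :=
  q n = 1 /\ forall j, (j < n)%N ->
    q j = ('X - 1) * \sum_(j <= i < n) h i j *: \sum_(i.+1 <= k < n.+1) q k.

Definition response n (H : 'M[R]_n) (j : nat) : {poly R} :=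
  if j == n then 1 else \sum_(1 <= m < n.+1) Qsum H m j.+1 *: ('X - 1) ^+ m.

(** For [k = n] the pairing with 1 is evaluation at 0, where [('X - 1)^m] gives the sign; for
    [k < n] it is [pdot_expXsub1] extended bilinearly. *)
Lemma certificateE n (H : 'M[R]_n) j k : (j < n)%N -> (k <= n)%N ->
  certificate H k.+1 j.+1 = - (n.+1%:R * pdot (response H j) (response H k)).
Proof.
move=> ltjn lekn; rewrite /certificate /response eqSS (ltn_eqF ltjn).
case: eqVneq => [_|nekn].
  rewrite -mulrN; congr (_ * _); rewrite pdot1 -horner_coef0 horner_sum -sumrN.
  apply: eq_big_nat => m /andP[m0 _].
  rewrite hornerZ horner_exp hornerXsubC sub0r -(prednK m0) exprS mulN1r /=.
  by rewrite mulrN opprK mulrC.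
rewrite -mulrN; congr (_ * _); rewrite pdot_suml -sumrN.
apply: eq_big_nat => l /andP[l0 _]; rewrite pdot_sumr -sumrN.
apply: eq_big_nat => m _; rewrite pdotZl pdotZr pdot_expXsub1.
have -> : (-1) ^+ (l + m) = - (-1) ^+ (l + m).-1 :> R.
  by rewrite -[in LHS](prednK (ltn_addr m l0)) exprS mulN1r.
by ring.
Qed.

(* Weights of the chains that can follow an entry of row i; for m = 0 only the
   empty continuation counts, with weight 1. *)
Definition Qtail n (H : 'M[R]_n) (m i : nat) : R :=
  if m == 0%N then 1 else \sum_(i.+1 <= k < n) Qsum H m k.+1.

Definition continues n (i : nat) (c : seq ('I_n * 'I_n)) : bool :=
  [&& all (fun p : 'I_n * 'I_n => p.2 <= p.1)%N c,
      sorted (fun p q : 'I_n * 'I_n => p.1 < q.2)%N c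
    & if c is p :: _ then i < p.2 else true]%N.

Lemma continues_sum n (H : 'M[R]_n) m i :
  \sum_(c : m.-tuple ('I_n * 'I_n) | continues i c) \prod_(p <- c) H p.1 p.2 =
  Qtail H m i.
Proof.
rewrite /Qtail; case: m => [|m] /=.
  rewrite (big_pred1 [tuple]) ?big_nil // => c.
  by rewrite (tuple0 c); symmetry; exact: eqxx.
rewrite big_geq_mkord.
rewrite (partition_big (fun c : m.+1.-tuple ('I_n * 'I_n) => (thead c).2)
  (fun k : 'I_n => i < k)%N) => [|c]; last first.
  by case/tupleP: c => p c /and3P[].
apply: eq_bigr => k ltik; apply: eq_bigl => c; case/tupleP: c => p c.
rewrite /continues /index_chain /= theadE -val_eqE /=.
have -> : (Some p.2.+1 == Some k.+1) = (p.2 == k :> nat) by [].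
case: eqVneq => [->|]; last by rewrite !andbF.
by rewrite ltik !andbT.
Qed.

(** A chain is its first pair together with a continuation above that pair's row; the column of the
    first pair is pinned to [j], so only its row [i] is summed. *)
Lemma Qsum_rec n (H : 'M[R]_n) m j :
  Qsum H m.+1 j.+1 = \sum_(j <= i < n) entry H i j * Qtail H m i.
Proof.
rewrite /Qsum.
rewrite (reindex (fun pc : ('I_n * 'I_n) * m.-tuple ('I_n * 'I_n) =>
  [tuple of pc.1 :: pc.2])) /=; last first.
  exists (fun c => (thead c, [tuple of behead c])) => [[p c] _|c _] /=.
    by congr (_, _); apply: val_inj.
  by rewrite -tuple_eta.
transitivity (\sum_(p : 'I_n * 'I_n | (p.2 == j :> nat) && (p.2 <= p.1)%N)
  H p.1 p.2 * Qtail H m p.1).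
  under [RHS]eq_bigr => p _ do rewrite -continues_sum mulr_sumr.
  rewrite pair_big_dep /=; apply: eq_big => [[p c]|[p c] _] /=; last by rewrite big_cons.
  rewrite /index_chain /continues /=.
  have -> : (Some p.2.+1 == Some j.+1) = (p.2 == j :> nat) by [].
  rewrite -!andbA; congr [&& _, _ & _].
  by case: (val c) => //= q c'; do !bool_congr.
rewrite big_geq_mkord -(pair_big_dep xpredT
  (fun k l : 'I_n => (l == j :> nat) && (l <= k)%N) (fun k l => H k l * Qtail H m k)) /=.
rewrite [RHS]big_mkcond; apply: eq_bigr => k _.
have [lejk|ltkj] := leqP j k; last first.
  by rewrite big_pred0 // => l; case: eqP => //= ->; rewrite leqNgt ltkj.
have ltjn := leq_ltn_trans lejk (ltn_ord k).
rewrite (big_pred1 (Ordinal ltjn)) => [|l].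
  by rewrite -(entryE _ k (Ordinal ltjn)).
by rewrite inE -val_eqE /=; case: eqP => //= ->.
Qed.

(** Columns strictly increase along a chain, so at most [n - j] pairs fit from column [j] on. *)
Lemma Qsum_long n (H : 'M[R]_n) m j : (n < m + j)%N -> Qsum H m j.+1 = 0.
Proof.
elim: m j => [|m IH] j ltn_mj.
  rewrite /Qsum big1 // => c; by rewrite (tuple0 c).
rewrite Qsum_rec; apply: big1_seq => i /andP[_].
rewrite mem_index_iota => /andP[leji ltin].
rewrite /Qtail; case: m IH ltn_mj => [|m] IH ltn_mj; first by lia.
rewrite /= big1_seq ?mulr0 // => k /andP[_].
by rewrite mem_index_iota => /andP[ltik ltkn]; apply: IH; lia.
Qed.

Lemma response_tail n (H : 'M[R]_n) i : (i < n)%N ->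
  \sum_(i.+1 <= k < n.+1) response H k = \sum_(0 <= m < n) Qtail H m i *: ('X - 1) ^+ m.
Proof.
move=> ltin; rewrite big_nat_recr //= [response H n]/response eqxx.
under eq_big_nat => k /andP[_ ltkn] do rewrite /response (ltn_eqF ltkn).
rewrite exchange_big_nat /= [RHS]big_ltn ?(leq_ltn_trans _ ltin) //.
rewrite {1}/Qtail /= expr0 scale1r addrC; congr (_ + _).
(* The top term [m = n] drops out: a chain starting at a column [k > i] has fewer than [n] pairs. *)
rewrite big_nat_recr ?(leq_ltn_trans _ ltin) //= [X in _ + X]big1_seq ?addr0.
  apply: eq_big_nat => m /andP[m0 _].
  by rewrite /Qtail gtn_eqF // scaler_suml.
move=> k /andP[_]; rewrite mem_index_iota => /andP[ltik _].
by rewrite Qsum_long ?scale0r // -addn1 leq_add2l (leq_ltn_trans _ ltik).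
Qed.

Lemma response_is_response n (H : 'M[R]_n) : is_response n (entry H) (response H).
Proof.
split=> [|j ltjn]; first by rewrite /response eqxx.
rewrite {1}/response (ltn_eqF ltjn) mulr_sumr.
under [RHS]eq_big_nat => i /andP[_ ltin] do rewrite response_tail // scaler_sumr mulr_sumr.
rewrite exchange_big_nat /= big_add1 /=; apply: eq_big_nat => m _.
rewrite Qsum_rec scaler_suml; apply: eq_bigr => i _.
by rewrite exprS scalerA -scalerAr.
Qed.

Lemma response_unique n h q q' : is_response n h q -> is_response n h q' ->
  forall j, (j <= n)%N -> q j = q' j.
Proof.
move=> [qn qj] [q'n q'j] j; have [m] := ubnP (n - j).
elim: m j => // m IH j lt_m; rewrite leq_eqVlt => /predU1P[->|ltjn]; first by rewrite qn.
rewrite qj // q'j //; congr (_ * _); apply: eq_big_nat => i /andP[leji ltin].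
congr (_ *: _); apply: eq_big_nat => k /andP[ltik ltkn]; apply: IH => //; lia.
Qed.

End Response.
(** * Gluing of H-matrices *)

Section Gluing.
Variable R : realType.
Implicit Types (h : nat -> nat -> R) (q : nat -> {poly R}).

Definition balanced n q : Prop := \sum_(0 <= j < n.+1) q j = n.+1%:R^-1 *: ones R n.+1.

(** By [certificateE] positive certificates are negative Gram entries. Positions in [G] are 0-based
    but its values are 1-based nodes, hence [k.+1]. *)
Definition arc_pattern n q (G : seq nat) : Prop := forall j k, (j < k <= n)%N ->
  if nth 0%N G j == k.+1 then is_true (pdot (q j) (q k) < 0) else pdot (q j) (q k) = 0.

Lemma response_root1 n h q j : is_response n h q -> (j < n)%N -> (q j).[1] = 0.
Proof. by move=> [_ qE] /qE->; rewrite hornerM !hornerE subrr mul0r. Qed.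

Lemma response_size_le n h q j : is_response n h q -> (j <= n)%N ->
  (size (q j) <= (n - j).+1)%N.
Proof.
move=> [qn qE]; have [m] := ubnP (n - j); elim: m j => // m IH j lt_m.
rewrite leq_eqVlt => /predU1P[->|ltjn]; first by rewrite qn size_poly1.
rewrite qE //; apply: leq_trans (size_polyMleq _ _) _.
rewrite -polyC1 size_XsubC /= ltnS.
apply: leq_trans (size_sum _ _ _) _; apply/bigmax_leqP_seq => i.
rewrite mem_index_iota => /andP[leji ltin] _.
apply: leq_trans (size_scale_leq _ _) _.
apply: leq_trans (size_sum _ _ _) _; apply/bigmax_leqP_seq => k.
rewrite mem_index_iota => /andP[ltik ltkn] _.
by apply: leq_trans (IH _ _ _) _; lia.
Qed.

Lemma response_tail_size_le n h q i : is_response n h q ->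
  (size (\sum_(i <= k < n.+1) q k)%R <= n.+1 - i)%N.
Proof.
move=> qR; apply: leq_trans (size_sum _ _ _) _; apply/bigmax_leqP_seq => k.
rewrite mem_index_iota => /andP[leik ltkn] _.
by apply: leq_trans (response_size_le qR _) _; lia.
Qed.

(** Degree [n - j] is reached in the tail by [q j] alone, and inside [q j] only by the diagonal term
    [i = j]. *)
Lemma tail_lead_rec n h q j : is_response n h q -> (j < n)%N ->
  (\sum_(j <= k < n.+1) q k)`_(n - j) =
  h j j * (\sum_(j.+1 <= k < n.+1) q k)`_(n - j.+1).
Proof.
move=> qR ltjn; have [qn qE] := qR.
rewrite big_ltn ?ltnS 1?ltnW // coefD addrC nth_default; last first.
  by apply: leq_trans (response_tail_size_le j.+1 qR) _; rewrite subSS.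
rewrite add0r qE // big_ltn // mulrDr coefD -[(n - j)%N]prednK ?subn_gt0 //.
have -> : (n - j).-1 = (n - j.+1)%N by lia.
rewrite mulrBl mul1r coefB coefXM /= coefZ.
rewrite [X in _ - X]nth_default ?subr0; last first.
  apply: leq_trans (size_scale_leq _ _) _.
  by apply: leq_trans (response_tail_size_le j.+1 qR) _; lia.
rewrite [X in _ + X]nth_default ?addr0 //.
apply: leq_trans (size_polyMleq _ _) _; rewrite -polyC1 size_XsubC /=.
rewrite ltnS; apply: leq_trans (size_sum _ _ _) _; apply/bigmax_leqP_seq => i.
rewrite mem_index_iota => /andP[leji ltin] _.
apply: leq_trans (size_scale_leq _ _) _.
by apply: leq_trans (response_tail_size_le i.+1 qR) _; lia.
Qed.

(** By balance the full sum has leading coefficient [1 / N], and by the recursion each later leading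
    coefficient is a factor of the previous one. *)
Lemma tail_lead_neq0 n h q j : is_response n h q -> balanced n q -> (j <= n)%N ->
  (\sum_(j <= k < n.+1) q k)`_(n - j) != 0.
Proof.
move=> qR bq; elim: j => [|j IH] ltjn.
  by rewrite bq subn0 coefZ coef_ones ltnSn mulr1 invr_eq0 pnatr_eq0.
by have := IH (ltnW ltjn); rewrite (tail_lead_rec qR) // mulf_eq0 negb_or => /andP[].
Qed.

Lemma response_size n h q j : is_response n h q -> balanced n q -> (j <= n)%N ->
  size (q j) = (n - j).+1.
Proof.
move=> qR bq lejn; apply/anti_leq; rewrite (response_size_le qR) //=.
rewrite ltnNge; apply/negP => /leq_sizeP /(_ _ (leqnn _)) qj0.
have := tail_lead_neq0 qR bq lejn; rewrite big_ltn ?ltnS // coefD qj0 add0r.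
rewrite nth_default ?eqxx //.
by apply: leq_trans (response_tail_size_le j.+1 qR) _; rewrite subSS.
Qed.

(** After cancelling ['X - 1], column [j] of [h] holds the coefficients of one polynomial in the
    tails [T l]; these have the distinct degrees [n - l - 1], hence are independent. *)
Lemma response_entry_unique n h h' q q' :
  is_response n h q -> is_response n h' q' -> balanced n q ->
  (forall j, (j <= n)%N -> q j = q' j) ->
  forall i j, (j <= i < n)%N -> h i j = h' i j.
Proof.
move=> qR qR' bq qq' i j; have [m] := ubnP i; elim: m i => // m IH i ltim /andP[leji ltin].
have ltjn := leq_ltn_trans leji ltin.
pose T l := \sum_(l.+1 <= k < n.+1) q k.
have : \sum_(j <= l < n) (h l j - h' l j) *: T l = 0.
  apply: (@mulfI _ ('X - 1)); first by rewrite -polyC1 polyXsubC_eq0.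
  under eq_bigr do rewrite scalerBl.
  rewrite big_split sumrN mulrBr mulr0 /= -(qR.2 _ ltjn) qq' 1?ltnW // (qR'.2 _ ltjn).
  apply/eqP; rewrite subr_eq0; apply/eqP; congr (_ * _); apply: eq_big_nat => l /andP[_ ltln].
  by congr (_ *: _); apply: eq_big_nat => k /andP[_ ltkn]; rewrite qq'.
(* In this degree the tails with [l > i] are too short, and those with [l < i] vanish by induction,
   so only [l = i] is left. *)
move/(congr1 (coefp (n - i.+1))) => /eqP; rewrite /coefp /= coef0 coef_sum.
rewrite (bigD1_seq i) ?mem_index_iota ?leji ?iota_uniq //=.
rewrite big1_seq ?addr0 => [|l /andP[neli]].
  by rewrite coefZ mulf_eq0 subr_eq0 (negPf (tail_lead_neq0 qR bq ltin)) orbF => /eqP.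
rewrite mem_index_iota => /andP[lejl ltln]; rewrite coefZ.
case: (ltngtP l i) neli => // [ltli|ltil] _.
  by rewrite IH ?subrr ?mul0r // ?lejl //; lia.
rewrite nth_default ?mulr0 //; apply: leq_trans (response_tail_size_le l.+1 qR) _.
by rewrite subSS; lia.
Qed.

Definition hglue n1 n2 h1 h2 (i j : nat) : R :=
  let N1 : R := n1.+1%:R in let N2 : R := n2.+1%:R in let N := N1 + N2 in
  if (i < n1)%N then (if (j < n1)%N then h1 i j else 0)
  else if i == n1 then
    if (j < n1)%N then - (N2 / N) * \sum_(0 <= k < n1) h1 k j
    else if j == n1 then N1 * N2 / N else 0
  else if (j < n1)%N then 0
  else if j == n1 then - (N1 / N) * \sum_(0 <= k < n2) h2 (i - n1.+1)%N k
  else h2 (i - n1.+1)%N (j - n1.+1)%N.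

(** The response family of the block matrix. The factor ['X^N2] moves the first family to degrees
    disjoint from those of the second; only the middle node [n1] meets both ranges. *)
Definition qglue n1 n2 q1 q2 (j : nat) : {poly R} :=
  let N1 : R := n1.+1%:R in let N2 : R := n2.+1%:R in let N := N1 + N2 in
  if (j < n1)%N then (N1 / N) *: ('X^(n2.+1) * q1 j)
  else if j == n1 then (N1 / N) *: ('X^(n2.+1) - N2^-1 *: ones R n2.+1)
  else q2 (j - n1.+1)%N.

(** * The response family of a glued matrix *)

Section GlueResponse.
Variables (n1 n2 : nat) (h1 h2 : nat -> nat -> R) (q1 q2 : nat -> {poly R}).
Hypotheses (qR1 : is_response n1 h1 q1) (qR2 : is_response n2 h2 q2).
Hypotheses (bq1 : balanced n1 q1) (bq2 : balanced n2 q2).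
Hypothesis trig1 : forall i j, (i < j)%N -> h1 i j = 0.
Hypothesis trig2 : forall i j, (i < j)%N -> h2 i j = 0.

Let n := (n1 + n2.+1)%N.
Let N1 : R := n1.+1%:R.
Let N2 : R := n2.+1%:R.
Let N := N1 + N2.
Let q := qglue n1 n2 q1 q2.
Let h := hglue n1 n2 h1 h2.

Let N1_neq0 : N1 != 0. Proof. by rewrite pnatr_eq0. Qed.
Let N2_neq0 : N2 != 0. Proof. by rewrite pnatr_eq0. Qed.
Let N_gt0 : 0 < N. Proof. by rewrite addr_gt0. Qed.
Let N_neq0 : N != 0. Proof. by rewrite gt_eqF. Qed.

Lemma qglue_high j : (n1 < j)%N -> q j = q2 (j - n1.+1)%N.
Proof. by move=> ltj; rewrite /q /qglue ltnNge ltnW //= gtn_eqF. Qed.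

Lemma qglue_mid : q n1 = (N1 / N) *: ('X^(n2.+1) - N2^-1 *: ones R n2.+1).
Proof. by rewrite /q /qglue ltnn eqxx. Qed.

Lemma qglue_low j : (j < n1)%N -> q j = (N1 / N) *: ('X^(n2.+1) * q1 j).
Proof. by move=> ltj; rewrite /q /qglue ltj. Qed.

Lemma qglue_tail_high i : (n1 < i)%N ->
  \sum_(i <= k < n.+1) q k = \sum_(i - n1.+1 <= k < n2.+1) q2 k.
Proof.
move=> lti; rewrite -{1}(subnK lti) big_addn.
have -> : (n.+1 - n1.+1 = n2.+1)%N by rewrite /n; lia.
by apply: eq_big_nat => k _; rewrite qglue_high ?addnK // leq_addl.
Qed.

Lemma qglue_tail_low i : (i <= n1)%N ->
  \sum_(i <= k < n.+1) q k =
  N^-1 *: ones R n2.+1 + (N1 / N) *: ('X^(n2.+1) * \sum_(i <= k < n1.+1) q1 k).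
Proof.
move=> lei.
rewrite (big_cat_nat (leqW lei) (ltac:(lia) : n1 < n.+1)%N) /=.
rewrite qglue_tail_high // subnn bq2 big_nat_recr // qglue_mid /=.
rewrite (big_nat_recr n1) //= (qR1.1) mulrDr mulr1.
under eq_big_nat => k /andP[_ ltk] do rewrite qglue_low //.
rewrite -scaler_sumr -mulr_sumr -/N2.
(* This splits the [ones] of the high tail into the claimed [N^-1] share and a share that cancels
   against the middle node. *)
have {2}-> : N2^-1 = N^-1 + N1 / N * N2^-1.
  by rewrite -{1}[N^-1]mulr1 -{1}(divff N2_neq0) mulrA [N^-1 * N2]mulrC -mulrDl -mulrDl addrC divff ?mul1r.
by rewrite -!mul_polyC polyCD polyCM; ring.
Qed.

Lemma qglue_balanced : balanced n q.
Proof.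
rewrite /balanced qglue_tail_low // bq1 -scalerAr scalerA.
have -> : N1 / N / n1.+1%:R = N^-1 by rewrite mulrAC divff // mul1r.
have -> : n.+1 = (n2.+1 + n1.+1)%N by rewrite /n; lia.
by rewrite -scalerDr -onesD natrD addrC.
Qed.

Lemma qglue_response : is_response n h q.
Proof.
split=> [|j ltjn].
  rewrite qglue_high /n ?addnS ?ltnS ?leq_addr //.
  by rewrite subSS addKn (qR2.1).
case: (ltngtP j n1) => [ltj|gtj|ej].
- rewrite qglue_low // (qR1.2) // (big_cat_nat (ltnW ltj) (leq_addr _ _ : n1 <= n)%N) /=.
  rewrite (@big_ltn _ _ _ n1) /=; last by rewrite /n; lia.
  rewrite [X in _ + (_ + X)]big1_seq ?addr0; last first.
    move=> i /andP[_]; rewrite mem_index_iota => /andP[lti _].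
    by rewrite /h /hglue ltnNge ltnW //= gtn_eqF // ltj scale0r.
  rewrite qglue_tail_high // subnn bq2 {2}/h /hglue ltnn eqxx ltj.
  have -> : \sum_(j <= i < n1) h i j *: \sum_(i.+1 <= k < n.+1) q k =
      \sum_(j <= i < n1) (h1 i j *: (N^-1 *: ones R n2.+1) +
        h1 i j *: ((N1 / N) *: ('X^(n2.+1) * \sum_(i.+1 <= k < n1.+1) q1 k))).
    apply: eq_big_nat => i /andP[_ lti].
    by rewrite qglue_tail_low // {1}/h /hglue lti ltj scalerDr.
  rewrite big_split /= -scaler_suml.
  (* Row [n1] was chosen for this: its contribution cancels the [N^-1 *: ones] parts of all the
     lower tails. *)
  have -> : (- (N2 / N) * \sum_(0 <= k < n1) h1 k j) *: (n2.+1%:R^-1 *: ones R n2.+1) =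
      - ((\sum_(j <= i < n1) h1 i j) *: (N^-1 *: ones R n2.+1)).
    rewrite (big_cat_nat (leq0n j) (ltnW ltj)) /= [X in X + _]big1_seq ?add0r; last first.
      by move=> k /andP[_]; rewrite mem_index_iota => /andP[_ /trig1].
    rewrite !scalerA -[RHS]scaleNr; congr (_ *: _).
    by rewrite mulrAC mulNr mulrAC mulfV // mul1r mulNr mulrC.
  rewrite addrAC subrr add0r mulr_sumr !mulr_sumr scaler_sumr.
  apply: eq_big_nat => i _.
  rewrite -!scalerAr !scalerA mulrCA; congr (_ *: _); first by rewrite mulrC.
- rewrite qglue_high // (qR2.2); last by rewrite /n in ltjn; lia.
  congr (_ * _); rewrite -[in RHS](subnK gtj) big_addn.
  have -> : (n - n1.+1 = n2)%N by rewrite /n; lia.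
  apply: eq_big_nat => i /andP[leji _]; rewrite qglue_tail_high ?leq_addl ?ltnS; last by lia.
  rewrite -addSn addnK; congr (_ *: _).
  rewrite /h /hglue; do !rewrite ifF; try lia.
  by rewrite !addnK.
- rewrite ej in ltjn *; rewrite qglue_mid (big_ltn ltjn) qglue_tail_high // subnn bq2.
  have -> : \sum_(n1.+1 <= i < n) h i n1 *: \sum_(i.+1 <= k < n.+1) q k =
      \sum_(0 <= i < n2) (- (N1 / N) * \sum_(0 <= k < n2) h2 i k) *:
        \sum_(i.+1 <= k < n2.+1) q2 k.
    rewrite -{1}[n1.+1]add0n big_addn.
    have -> : (n - n1.+1 = n2)%N by rewrite /n; lia.
    apply: eq_big_nat => i _; rewrite qglue_tail_high; last by lia.
    rewrite -addSn addnK; congr (_ *: _).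
    rewrite /h /hglue; do !(rewrite ifF; last by lia).
    by rewrite eqxx addnK.
  under eq_bigr => i _ do rewrite -scalerA scaler_suml.
  rewrite -scaler_sumr exchange_big_nat /= mulrDr -[X in _ = _ + X]scalerAr mulr_sumr.
  (* By its recursion the left side is the sum of [q2 k] over [k < n2], which balance evaluates. *)
  have -> : \sum_(0 <= k < n2) ('X - 1) *
      \sum_(0 <= i < n2) h2 i k *: \sum_(i.+1 <= l < n2.+1) q2 l =
      N2^-1 *: ones R n2.+1 - 1.
    rewrite -[X in X *: _]/(n2.+1%:R^-1) -bq2 big_nat_recr //= (qR2.1) addrK.
    apply: eq_big_nat => k /andP[_ ltk]; rewrite (qR2.2) //; congr (_ * _).
    rewrite (big_cat_nat (leq0n k) (ltnW ltk)) /= [X in X + _]big1_seq ?add0r //.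
    by move=> i /andP[_]; rewrite mem_index_iota => /andP[_ /trig2->]; rewrite scale0r.
  rewrite {1}/h /hglue ltnn eqxx -/N1 -/N2 -/N scalerA -scalerAr.
  have -> : N1 * N2 / N / N2 = N1 / N by rewrite mulrAC mulfK.
  have -> : ('X - 1) * ones R n2.+1 = 'X^(n2.+1) - 1.
    by rewrite -opprB mulNr ones_sub opprB.
  by rewrite scaleNr -scalerBr opprB addrA subrK.
Qed.

(** Low nodes keep the Gram entries of [q1] up to a positive factor and are orthogonal to high nodes
    by disjoint degrees; high nodes keep those of [q2]. Pairing the middle node with a high one is a
    negative multiple of evaluation at 1, nonzero only at the last node: this is the arc added by
    the gluing. *)
Lemma qglue_pattern G1 G2 : size G1 = n1 -> size G2 = n2 ->
  (forall j, (j < n1)%N -> (nth 0%N G1 j <= n1.+1)%N) ->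
  arc_pattern n1 q1 G1 -> arc_pattern n2 q2 G2 -> arc_pattern n q (gluing G1 G2).
Proof.
move=> sz1 sz2 rg1 pat1 pat2 j k /andP[ltjk lekn].
have N12_gt0 : 0 < N1 / N by rewrite divr_gt0.
rewrite /gluing nth_cat sz1 sz2.
case: (ltngtP j n1) => [ltj|gtj|ej].
- rewrite (qglue_low ltj); case: (ltngtP k n1) => [ltk|gtk|ek].
  + rewrite (qglue_low ltk) !pdotZl !pdotZr pdot_mulXn.
    have := pat1 j k; rewrite ltjk (ltnW ltk) => /(_ isT).
    by case: ifP => _; [rewrite !pmulr_rlt0|move->; rewrite !mulr0].
  + rewrite ifF; last by have := rg1 j ltj; lia.
    rewrite pdotZl qglue_high // pdot_mulXn_small ?mulr0 //.
    by apply: leq_trans (response_size_le qR2 _) _; rewrite /n in lekn *; lia.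
  + rewrite ek qglue_mid !pdotZl !pdotZr pdotBr pdotZr.
    rewrite [X in _ - _ * X]pdot_mulXn_small ?size_ones // mulr0 subr0.
    rewrite -[X in pdot _ X]mulr1 pdot_mulXn -(qR1.1).
    have := pat1 j n1; rewrite ltj leqnn => /(_ isT).
    by case: ifP => _; [rewrite !pmulr_rlt0|move->; rewrite !mulr0].
- rewrite (qglue_high gtj) (qglue_high (ltn_trans gtj ltjk)).
  have -> : (j - n1 = (j - n1.+1).+1)%N by lia.
  rewrite /= (nth_map 0%N); last by rewrite sz2; rewrite /n in lekn; lia.
  have -> : (n1.+1 + nth 0 G2 (j - n1.+1) == k.+1)%N = (nth 0 G2 (j - n1.+1) == (k - n1.+1).+1)%N.
    by lia.
  by apply: pat2; rewrite /n in lekn; lia.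
- rewrite ej in ltjk *; rewrite subnn /= qglue_mid qglue_high //.
  have szk : (size (q2 (k - n1.+1)) <= n2.+1)%N.
    by apply: leq_trans (response_size_le qR2 _) _; rewrite /n in lekn *; lia.
  rewrite pdotZl pdotBl pdotZl pdot_ones // -['X^(n2.+1)]mulr1 pdot_mulXn_small // sub0r.
  case: ifP => [/eqP ek|nek].
    have -> : (k - n1.+1 = n2)%N by rewrite /n in lekn *; lia.
    by rewrite (qR2.1) hornerC mulr1 pmulr_rlt0 // oppr_lt0 invr_gt0.
  by rewrite (response_root1 qR2) ?mulr0 ?oppr0 ?mulr0 //; rewrite /n in lekn *; lia.
Qed.

End GlueResponse.
End Gluing.
(** * Uniqueness of the vertex of a basic diagram *)

Section Uniqueness.
Variable R : realType.
Implicit Types (p : {poly R}) (q : nat -> {poly R}).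

(** With one test polynomial in each degree below [m] the equations are triangular and are solved
    from degree 0 upwards. *)
Lemma pdot_triangular_eq0 m p :
  (forall t, (t < m)%N -> exists2 r : {poly R}, size r = t.+1 & pdot p r = 0) ->
  forall t, (t < m)%N -> p`_t = 0.
Proof.
move=> orth t; have [b] := ubnP t; elim: b t => // b IH t lt_tb lt_tm.
have [r szr] := orth t lt_tm.
rewrite pdotC /pdot szr big_ord_recr /= big1 ?add0r => [|s _]; last first.
  by rewrite IH ?mulr0 //; have := ltn_ord s; lia.
move/eqP; rewrite mulf_eq0 => /orP[|/eqP//].
by have := lead_coef_eq0 r; rewrite /lead_coef szr /= => -> /eqP r0; rewrite r0 size_poly0 in szr.
Qed.

(** The properties of a response family that do not mention a matrix, so that they can be
    established for the two pieces of a split family. *)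
Definition response_family n q : Prop :=
  [/\ q n = 1, forall j, (j < n)%N -> (q j).[1] = 0,
      forall j, (j <= n)%N -> size (q j) = (n - j).+1 & balanced n q].

Lemma response_is_family n h q : is_response n h q -> balanced n q -> response_family n q.
Proof.
move=> qR bq; split=> // [|j ltjn|j lejn]; first by case: qR.
- exact: response_root1 qR ltjn.
- exact: response_size qR bq lejn.
Qed.

(** * Splitting a family at the gluing node *)

Section Split.
Variables (n1 n2 : nat) (q : nat -> {poly R}).
Let n := (n1 + n2.+1)%N.
Let N1 : R := n1.+1%:R.
Let N2 : R := n2.+1%:R.
Let N := N1 + N2.
Let N1_neq0 : N1 != 0. Proof. by rewrite pnatr_eq0. Qed.
Let N2_neq0 : N2 != 0. Proof. by rewrite pnatr_eq0. Qed.
Let N_gt0 : 0 < N. Proof. by rewrite addr_gt0. Qed.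
Let N_neq0 : N != 0. Proof. by rewrite gt_eqF. Qed.

Hypothesis qF : response_family n q.
Hypothesis orth_low : forall j k, (j < n1)%N -> (n1 < k <= n)%N -> pdot (q j) (q k) = 0.
Hypothesis orth_mid : forall k, (n1 < k < n)%N -> pdot (q n1) (q k) = 0.

Let high t : (t < n2.+1)%N -> exists k, [/\ (n1 < k <= n)%N, size (q k) = t.+1 & (0 < t)%N -> (k < n)%N].
Proof.
move=> lt; exists (n - t)%N; case: qF => _ _ sz _; split; first by rewrite /n; lia.
  by rewrite sz ?leq_subr //; congr S; rewrite /n; lia.
by rewrite /n; lia.
Qed.

(** The high nodes provide a polynomial of each degree from 0 to [n2], all orthogonal to [q j]. *)
Let low_coef j t : (j < n1)%N -> (t < n2.+1)%N -> (q j)`_t = 0.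
Proof.
move=> ltj; apply: pdot_triangular_eq0 => {}t ltt.
by have [k [hk szk _]] := high ltt; exists (q k) => //; apply: orth_low.
Qed.

Let mid_coef t : (t < n2.+1)%N -> (q n1)`_t = (q n1)`_0.
Proof.
move=> ltt; pose p := q n1 - (q n1)`_0 *: ones R n2.+1.
suff : p`_t = 0 by rewrite coefB coefZ coef_ones ltt mulr1 => /eqP; rewrite subr_eq0 => /eqP.
case: qF => qn root1 _ _; move: t ltt; apply: pdot_triangular_eq0 => t ltt.
have [k [hk szk hkn]] := high ltt; exists (q k) => //.
rewrite pdotBl pdotZl pdot_ones ?szk //.
case: (posnP t) => [t0|t_gt0]; last first.
  by rewrite orth_mid ?root1 ?mulr0 ?subrr ?hkn //; have := hkn t_gt0; lia.
have := szk; rewrite t0 => /eqP/size_poly1P[c _ ->].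
rewrite hornerC -[c%:P]alg_polyC pdotZr pdot1 mulrC subrr //.
Qed.

Let tail_coef t : (t < n2.+1)%N ->
  (\sum_(n1.+1 <= k < n.+1) q k)`_t = N^-1 - (q n1)`_0.
Proof.
case: (qF) => qn root1 sz bq.
move=> ltt; have := congr1 (coefp t) bq; rewrite /coefp /= coefZ coef_ones.
have -> : (t < n.+1)%N by rewrite /n; lia.
have -> : n.+1 = (n1.+1 + n2.+1)%N by rewrite /n.
rewrite natrD mulr1 -/N => <-.
have le1 : (n1 <= n1.+1 + n2.+1)%N by lia.
have le2 : (n1 < n1.+1 + n2.+1)%N by lia.
rewrite (big_cat_nat (leq0n n1) le1) /= (big_ltn le2) !coefD mid_coef //.
rewrite [X in _ = X + _ - _]coef_sum [X in _ = X + _ - _]big1_seq ?add0r => [|j /andP[_]]; last first.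
  by rewrite mem_index_iota => /andP[_ ltj]; rewrite low_coef.
by rewrite [RHS]addrC addKr.
Qed.

Let nE : n = (n1.+1 + n2)%N. Proof. by rewrite /n; lia. Qed.

(** Balance of the whole family leaves a multiple of [ones] for the high part. Evaluation at 1,
    where only the last node contributes, makes the factor [1 / N2]. *)
Lemma family_high : response_family n2 (fun j => q (n1.+1 + j)%N).
Proof.
case: (qF) => qn root1 sz bq.
have tail_ones : \sum_(n1.+1 <= k < n.+1) q k = (N^-1 - (q n1)`_0) *: ones R n2.+1.
  apply/polyP => t; rewrite coefZ coef_ones; case: ltnP => [ltt|let_].
    by rewrite mulr1 tail_coef.
  rewrite mulr0 nth_default //; apply: leq_trans (size_sum _ _ _) _.
  apply/bigmax_leqP_seq => k; rewrite mem_index_iota => /andP[ltk lekn] _.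
  by rewrite sz //; rewrite /n in lekn *; lia.
split=> [|j ltj|j lej|]; first by rewrite -nE.
- by apply: root1; rewrite nE ltn_add2l.
- by rewrite sz ?nE ?leq_add2l // subnDl.
rewrite /balanced.
have -> : \sum_(0 <= j < n2.+1) q (n1.+1 + j)%N = \sum_(n1.+1 <= k < n.+1) q k.
  rewrite -{2}[n1.+1]add0n big_addn nE -addnS addKn.
  by apply: eq_bigr => j _; rewrite addnC.
rewrite tail_ones; congr (_ *: _).
have := congr1 (fun p => p.[1]) tail_ones; rewrite /= hornerZ horner_ones.
have -> : (\sum_(n1.+1 <= k < n.+1) q k).[1] = 1.
  rewrite big_nat_recr /=; last by rewrite nE leq_addr.
  rewrite qn hornerD hornerC horner_sum big1_seq ?add0r // => k /andP[_].
  by rewrite mem_index_iota => /andP[_ /root1].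
by move=> /(congr1 ( *%R^~ N2^-1)) /=; rewrite mul1r mulfK.
Qed.

Let mid_coef0 : (q n1)`_0 = N^-1 - N2^-1.
Proof.
have [_ _ _] := family_high; rewrite /balanced => /(congr1 (coefp 0)).
rewrite /coefp /= coefZ coef_ones mulr1 -/N2 => <-.
have -> : \sum_(0 <= j < n2.+1) q (n1.+1 + j)%N = \sum_(n1.+1 <= k < n.+1) q k.
  rewrite -{2}[n1.+1]add0n big_addn nE -addnS addKn.
  by apply: eq_bigr => j _; rewrite addnC.
by rewrite tail_coef // opprB addrC subrK.
Qed.

(** Inverts the low branch of [qglue]; the value 1 at [n1] stands for the leading part of the middle
    node. *)
Definition family_low (j : nat) : {poly R} :=
  if j == n1 then 1 else (N / N1) *: drop_poly n2.+1 (q j).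

Lemma family_lowE j : (j < n1)%N -> q j = (N1 / N) *: ('X^(n2.+1) * family_low j).
Proof.
move=> ltj; rewrite /family_low ltn_eqF //.
rewrite -scalerAr scalerA -invf_div mulVf ?mulf_neq0 ?invr_eq0 // scale1r.
rewrite -[LHS](poly_take_drop n2.+1) mulrC [take_poly _ _](_ : _ = 0) ?add0r //.
by apply/polyP => t; rewrite coef_take_poly coef0; case: ifP => // ltt; rewrite low_coef.
Qed.

(** The degree is [N2] and the lower coefficients all equal [N^-1 - N2^-1]; the root at 1 then fixes
    the leading coefficient. *)
Lemma family_midE : q n1 = (N1 / N) *: ('X^(n2.+1) - N2^-1 *: ones R n2.+1).
Proof.
case: (qF) => qn root1 sz bq.
have szm : size (q n1) = n2.+2 by rewrite sz ?leq_addr // addKn.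
have qE : q n1 = (N^-1 - N2^-1) *: ones R n2.+1 + (q n1)`_(n2.+1) *: 'X^(n2.+1).
  apply/polyP => t; rewrite coefD !coefZ coef_ones coefXn.
  case: (ltngtP t n2.+1) => [ltt|gtt|->]; rewrite ?mulr0 ?mulr1 ?addr0 ?add0r //.
    by rewrite mid_coef ?mid_coef0.
  by rewrite nth_default // szm.
have := root1 n1; rewrite -addn1 leq_add2l => /(_ isT).
rewrite {1}qE hornerD !hornerZ horner_ones hornerXn expr1n mulr1 -/N2 => /eqP.
rewrite addrC addr_eq0 => /eqP lead.
have lead' : (q n1)`_(n2.+1) = N1 / N.
  rewrite lead mulrBl mulVf // opprB; apply: (mulIf N_neq0).
  by rewrite mulrBl mul1r divfK // mulrAC mulVf // mul1r /N addrK.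
rewrite qE lead' scalerBr addrC; congr (_ + _); rewrite scalerA -scaleNr; congr (_ *: _).
have {1}-> : N2^-1 = N^-1 + N1 / N * N2^-1.
  by rewrite -{1}[N^-1]mulr1 -{1}(divff N2_neq0) mulrA [N^-1 * N2]mulrC -mulrDl -mulrDl addrC divff ?mul1r.
by rewrite opprD addrA subrr add0r.
Qed.

Lemma family_low_family : response_family n1 family_low.
Proof.
case: (qF) => qn root1 sz bq.
have c_neq0 : N / N1 != 0 by rewrite mulf_neq0 ?invr_eq0.
split=> [|j ltj|j lej|]; first by rewrite /family_low eqxx.
- have := root1 j; rewrite ltn_addr // => /(_ isT); rewrite (family_lowE ltj).
  rewrite hornerZ hornerM hornerXn expr1n mul1r => /eqP.
  by rewrite mulf_eq0 -invf_div invr_eq0 (negPf c_neq0) => /eqP.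
- rewrite /family_low; case: eqVneq => [->|nej]; first by rewrite size_poly1 subnn.
  rewrite size_scale // size_drop_poly sz; last by rewrite /n; lia.
  by rewrite /n; lia.
apply/polyP => t; rewrite coefZ coef_ones.
(* Balance of [family_low] in degree [t] is balance of [q] in degree [t + N2], where the high nodes
   contribute nothing and the middle node only its leading term. *)
have := congr1 (coefp (t + n2.+1)) bq; rewrite /coefp /= coefZ coef_ones.
have -> : (t + n2.+1 < n.+1)%N = (t < n1.+1)%N by rewrite /n; lia.
have -> : n.+1%:R = N by rewrite nE -addnS natrD.
move=> e; apply: (mulfI (invr_neq0 c_neq0)).
rewrite mulrA invf_div [N1 / N / N1]mulrAC divff // mul1r -e.
have le1 : (n1 <= n.+1)%N by rewrite /n; lia.
have le2 : (n1 < n.+1)%N by rewrite /n; lia.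
rewrite (big_cat_nat (leq0n n1) le1) /= (big_ltn le2) !coefD.
rewrite [X in _ = _ + (_ + X)]nth_default ?addr0; last first.
  apply: leq_trans (size_sum _ _ _) _.
  apply/bigmax_leqP_seq => k; rewrite mem_index_iota => /andP[ltk lekn] _.
  by rewrite sz //; rewrite /n in lekn *; lia.
rewrite big_nat_recr //= coefD mulrDr; congr (_ + _).
  rewrite !coef_sum mulr_sumr; apply: eq_big_nat => j /andP[_ ltj].
  rewrite /family_low ltn_eqF // coefZ mulrA -invf_div mulVf ?mul1r //.
  by rewrite coef_drop_poly.
rewrite /family_low eqxx family_midE coefZ coefB coefZ coef_ones coefXn coef1.
rewrite ltnNge leq_addl mulr0 subr0; congr (_ * _%:R).
by rewrite -{2}[n2.+1]add0n eqn_add2r.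
Qed.

Lemma family_glue j : (j <= n)%N ->
  q j = qglue n1 n2 family_low (fun j => q (n1.+1 + j)%N) j.
Proof.
move=> lejn; rewrite /qglue; case: ltngtP => [ltj|gtj|->].
- exact: family_lowE.
- by rewrite subnKC.
- exact: family_midE.
Qed.

Lemma family_low_pattern G1 :
  (forall j k, (j < k <= n1)%N -> nth 0%N G1 j != k.+1 -> pdot (q j) (q k) = 0) ->
  forall j k, (j < k <= n1)%N -> nth 0%N G1 j != k.+1 ->
    pdot (family_low j) (family_low k) = 0.
Proof.
move=> pat j k /andP[ltjk lek] nek; have := pat j k; rewrite ltjk lek => /(_ isT nek).
have c_neq0 : N1 / N != 0 by rewrite mulf_neq0 ?invr_eq0.
rewrite family_lowE ?(leq_trans ltjk) // !pdotZl.
move: lek; rewrite leq_eqVlt => /predU1P[->|ltk].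
  rewrite family_midE pdotZr pdotBr pdotZr [X in _ - _ * X]pdot_mulXn_small ?size_ones //.
  rewrite mulr0 subr0 -[X in pdot _ X]mulr1 pdot_mulXn [family_low n1](_ : _ = 1); last by rewrite /family_low eqxx.
  by move/eqP; rewrite mulf_eq0 (negPf c_neq0) mulf_eq0 (negPf c_neq0) => /eqP.
rewrite family_lowE // pdotZr pdot_mulXn.
by move/eqP; rewrite mulf_eq0 (negPf c_neq0) mulf_eq0 (negPf c_neq0) => /eqP.
Qed.

End Split.

Definition zero_pattern n q (G : seq nat) : Prop := forall j k, (j < k <= n)%N ->
  nth 0%N G j != k.+1 -> pdot (q j) (q k) = 0.

Lemma size_gluing G1 G2 : size (gluing G1 G2) = (size G1 + (size G2).+1)%N.
Proof. by rewrite size_cat /= size_map. Qed.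

Lemma nth_gluing_low G1 G2 j : (j < size G1)%N -> nth 0%N (gluing G1 G2) j = nth 0%N G1 j.
Proof. by move=> ltj; rewrite nth_cat ltj. Qed.

Lemma nth_gluing_mid G1 G2 : nth 0%N (gluing G1 G2) (size G1) = ((size G1).+1 + (size G2).+1)%N.
Proof. by rewrite nth_cat ltnn subnn. Qed.

Lemma nth_gluing_high G1 G2 j : (j < size G2)%N ->
  nth 0%N (gluing G1 G2) ((size G1).+1 + j) = ((size G1).+1 + nth 0%N G2 j)%N.
Proof.
move=> ltj; rewrite nth_cat ltnNge addSnnS leq_addr /= addKn /=.
by rewrite (nth_map 0%N).
Qed.

Lemma basic_arcs G j : basic G -> (j < size G)%N -> (j.+1 < nth 0%N G j <= (size G).+1)%N.
Proof.
move=> bG; elim: bG j => // G1 G2 _ IH1 _ IH2 j; rewrite size_gluing => ltj.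
case: (ltngtP j (size G1)) => [ltj1|gtj1|->].
- by rewrite nth_gluing_low //; have := IH1 j ltj1; lia.
- rewrite -(subnKC gtj1) nth_gluing_high; last by lia.
  by have := IH2 (j - (size G1).+1)%N; lia.
- by rewrite nth_gluing_mid; lia.
Qed.

(** Induction on the gluing. Arcs of [G1] stay among its own nodes and the middle node has its only
    arc to the last node, so both families split by [family_glue] into pieces covered by the
    induction hypotheses. *)
Lemma response_family_unique G q q' : basic G ->
  response_family (size G) q -> zero_pattern (size G) q G ->
  response_family (size G) q' -> zero_pattern (size G) q' G ->
  forall j, (j <= size G)%N -> q j = q' j.
Proof.
move=> bG; elim: bG q q' => [|G1 G2 bG1 IH1 bG2 IH2] q q'.
  by move=> [qn _ _ _] _ [qn' _ _ _] _ j; rewrite leqn0 => /eqP->; rewrite qn.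
rewrite size_gluing => qF pat qF' pat' j lej.
have low (p : nat -> {poly R}) : zero_pattern (size G1 + (size G2).+1) p (gluing G1 G2) -> forall i k,
    (i < size G1)%N -> (size G1 < k <= size G1 + (size G2).+1)%N -> pdot (p i) (p k) = 0.
  move=> pp i k lti /andP[ltk lek]; apply: pp; first by rewrite lek (ltn_trans lti).
  by rewrite nth_gluing_low //; have := basic_arcs bG1 lti; lia.
have mid (p : nat -> {poly R}) : zero_pattern (size G1 + (size G2).+1) p (gluing G1 G2) -> forall k,
    (size G1 < k < size G1 + (size G2).+1)%N -> pdot (p (size G1)) (p k) = 0.
  move=> pp k hk; apply: pp; first by lia.
  by rewrite nth_gluing_mid; lia.
have patlow (p : nat -> {poly R}) : zero_pattern (size G1 + (size G2).+1) p (gluing G1 G2) ->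
    zero_pattern (size G1) p G1.
  move=> pp i k hk nek; apply: pp; first by lia.
  by rewrite nth_gluing_low //; lia.
have pathigh (p : nat -> {poly R}) : zero_pattern (size G1 + (size G2).+1) p (gluing G1 G2) ->
    zero_pattern (size G2) (fun i => p ((size G1).+1 + i)%N) G2.
  move=> pp i k hk nek; apply: pp; first by lia.
  by rewrite nth_gluing_high; lia.
rewrite (family_glue qF (low _ pat) (mid _ pat)) //.
rewrite (family_glue qF' (low _ pat') (mid _ pat')) // /qglue.
case: ltngtP => // [ltj|gtj].
  congr (_ *: _); congr (_ * _); apply: IH1; rewrite 1?ltnW //.
  - exact: family_low_family qF (low _ pat) (mid _ pat).
  - exact: family_low_pattern qF (low _ pat) (mid _ pat) _ (patlow _ pat).
  - exact: family_low_family qF' (low _ pat') (mid _ pat').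
  - exact: family_low_pattern qF' (low _ pat') (mid _ pat') _ (patlow _ pat').
apply: (IH2 (fun i => q ((size G1).+1 + i)%N) (fun i => q' ((size G1).+1 + i)%N)).
- exact: family_high qF (low _ pat) (mid _ pat).
- exact: pathigh.
- exact: family_high qF' (low _ pat') (mid _ pat').
- exact: pathigh.
- by lia.
Qed.

End Uniqueness.
(** * Optimality: sufficiency and necessity *)

Section Certificate.
Variables (R : realType) (X : lmodType R) (dot : {dot X for idfun}).
Variables (n : nat) (h : nat -> nat -> R) (q : nat -> {poly R}).
Hypothesis qR : is_response n h q.
Hypothesis bq : balanced n q.

Let sq (x : X) : R := dot x x.
Let N : R := n.+1%:R.
Let N_neq0 : N != 0. Proof. by rewrite pnatr_eq0. Qed.

Lemma sqB x y : sq (x - y) = sq x + sq y - 2 * dot x y.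
Proof. by rewrite /sq !dotE (dotC _ y x); ring. Qed.

(** By balance row [j] of the Gram matrix sums to [(q j).[1] / N], which is [1 / N] for [j = n] and
    0 otherwise. Polarizing [dot (a j) (a k)] then leaves only squared differences and
    [sq (a n)]. *)
Lemma gram_laplacian (a : nat -> X) :
  N * (\sum_(0 <= t < n.+1) sq (\sum_(0 <= j < n.+1) (q j)`_t *: a j)) =
  sq (a n) - N / 2 * \sum_(0 <= j < n.+1) \sum_(0 <= k < n.+1)
    pdot (q j) (q k) * sq (a j - a k).
Proof.
have rowsum j : (j < n.+1)%N -> \sum_(0 <= k < n.+1) pdot (q j) (q k) = (j == n)%:R / N.
  move=> ltj; rewrite -pdot_sumr bq pdotZr pdotC pdot_ones; last first.
    by apply: leq_trans (response_size_le qR _) _; lia.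
  rewrite mulrC; case: eqP => [->|/eqP nej]; first by rewrite (qR.1) hornerC.
  by rewrite (response_root1 qR) //; lia.
have diag : \sum_(0 <= j < n.+1) \sum_(0 <= k < n.+1) pdot (q j) (q k) * sq (a j) = sq (a n) / N.
  rewrite (eq_big_nat _ _ (F2 := fun j => (j == n)%:R / N * sq (a j))); last first.
    by move=> j /andP[_ ltj]; rewrite -mulr_suml rowsum.
  rewrite big_nat_recr //= eqxx big1_seq ?add0r ?mul1r 1?mulrC // => j /andP[_].
  by rewrite mem_index_iota => /andP[_ ltj]; rewrite ltn_eqF // !mul0r.
have diag' : \sum_(0 <= j < n.+1) \sum_(0 <= k < n.+1) pdot (q j) (q k) * sq (a k) = sq (a n) / N.
  rewrite exchange_big_nat /= -diag; apply: eq_bigr => j _; apply: eq_bigr => k _.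
  by rewrite pdotC.
pose C := \sum_(0 <= j < n.+1) \sum_(0 <= k < n.+1) pdot (q j) (q k) * dot (a j) (a k).
have -> : \sum_(0 <= j < n.+1) \sum_(0 <= k < n.+1) pdot (q j) (q k) * sq (a j - a k) =
    2 * (sq (a n) / N) - 2 * C.
  rewrite mulrDl mul1r -{1}diag -{1}diag' mulr_sumr -big_split -sumrB.
  apply: eq_bigr => j _; rewrite mulr_sumr -big_split -sumrB.
  by apply: eq_bigr => k _; rewrite sqB /=; ring.
have -> : \sum_(0 <= t < n.+1) sq (\sum_(0 <= j < n.+1) (q j)`_t *: a j) = C.
  under eq_bigr => t _ do rewrite /sq dot_suml.
  rewrite exchange_big_nat /=; apply: eq_big_nat => j /andP[_ ltj].
  under eq_bigr => t _ do rewrite dot_sumr.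
  rewrite exchange_big_nat /=; apply: eq_big_nat => k /andP[_ ltk].
  rewrite (@pdot_wide _ n.+1); last by apply: leq_trans (response_size_le qR _) _; lia.
  rewrite big_mkord mulr_suml; apply: eq_bigr => t _.
  by rewrite dotZl dotZr mulrA.
by field.
Qed.

Variables y g : nat -> X.
Hypothesis yE : forall k, (k < n)%N -> y k.+1 = y k - \sum_(0 <= j < k.+1) h k j *: g j.

Let S0 := \sum_(0 <= j < n.+1) q j.
Let B j := \sum_(j <= i < n) h i j *: \sum_(i.+1 <= k < n.+1) q k.

(** Each iterate is unrolled down to [y 0] and the sums are exchanged; the weight collected by [g l]
    is [B l], the quotient of [q l] by ['X - 1]. *)
Lemma response_by_parts t :
  \sum_(0 <= j < n.+1) (q j)`_t *: y j = S0`_t *: y 0%N - \sum_(0 <= j < n) (B j)`_t *: g j.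
Proof.
have yj j : (j < n.+1)%N -> y j = y 0%N - \sum_(0 <= i < n | (i < j)%N)
    \sum_(0 <= l < n | (l <= i)%N) h i l *: g l.
  move=> ltj.
  suff -> : y j = y 0%N - \sum_(0 <= i < j) \sum_(0 <= l < n | (l <= i)%N) h i l *: g l.
    by rewrite (big_nat_widen 0 j n).
  elim: j ltj => [|j IH] ltj; first by rewrite big_geq ?subr0.
  rewrite yE // IH 1?ltnW // -addrA -opprD [in RHS]big_nat_recr //=; congr (_ - (_ + _)).
  by rewrite (big_nat_widen _ _ n).
rewrite (eq_big_nat _ _ (F2 := fun j => (q j)`_t *: y 0%N - (q j)`_t *:
    \sum_(0 <= i < n | (i < j)%N) \sum_(0 <= l < n | (l <= i)%N) h i l *: g l)); last first.
  by move=> j /andP[_ ltj]; rewrite -scalerBr -yj.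
rewrite sumrB -scaler_suml /S0 coef_sum; congr (_ - _).
under eq_bigr => j _ do rewrite scaler_sumr.
rewrite (exchange_big_dep_nat xpredT) //=.
transitivity (\sum_(0 <= i < n) \sum_(0 <= l < n | (l <= i)%N)
    (h i l * (\sum_(i.+1 <= k < n.+1) q k)`_t) *: g l).
  apply: eq_bigr => i _; rewrite -scaler_suml.
  have -> : \sum_(0 <= j < n.+1 | (i < j)%N) (q j)`_t = (\sum_(i.+1 <= k < n.+1) q k)`_t.
    by rewrite coef_sum [RHS](big_nat_widenl _ 0).
  rewrite scaler_sumr.
  by apply: eq_bigr => l _; rewrite scalerA mulrC.
rewrite (exchange_big_dep_nat xpredT) //=; apply: eq_bigr => l _.
rewrite /B coef_sum scaler_suml [RHS](big_nat_widenl _ 0) //=.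
by apply: eq_bigr => i _; rewrite coefZ.
Qed.

Lemma response_B j : (j < n)%N -> q j = ('X - 1) * B j.
Proof. exact: qR.2. Qed.

(** In degree 0 the coefficients of [q j] and [B j] are opposite, so every [g j] with [j < n]
    cancels. *)
Lemma transfer_coef0 :
  \sum_(0 <= j < n.+1) (q j)`_0 *: (y j - g j) = S0`_0 *: y 0%N - g n.
Proof.
under eq_bigr do rewrite scalerBr.
rewrite sumrB response_by_parts big_nat_recr //= (qR.1) coef1 scale1r opprD addrA.
congr (_ - _); rewrite -addrA -opprD -big_split big1_seq ?subr0 // => j /andP[_].
rewrite mem_index_iota => /andP[_ ltj]; rewrite response_B //.
by rewrite mulrBl mul1r coefB coefXM sub0r scaleNr /= subrr.
Qed.

(** Since [q j = ('X - 1) * B j], subtracting the [g j] replaces degree [t + 1] of [B j] by degree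
    [t]. With [g = y - T y] and [T] linear, [T] thus lowers the degree by one, up to a multiple of
    [y 0]. *)
Lemma transfer_coefS t :
  \sum_(0 <= j < n.+1) (q j)`_t.+1 *: (y j - g j) =
  \sum_(0 <= j < n.+1) (q j)`_t *: y j + (S0`_t.+1 - S0`_t) *: y 0%N.
Proof.
under eq_bigr do rewrite scalerBr.
rewrite sumrB !response_by_parts big_nat_recr //= (qR.1) coef1 scale0r addr0.
rewrite scalerBl [RHS]addrC addrA subrK -!addrA; congr (_ + _).
rewrite -opprD -big_split; congr (- _); apply: eq_big_nat => j /andP[_ ltj].
rewrite response_B // mulrBl mul1r coefB coefXM /= -scalerDl addrC subrK //.
Qed.

(** [gram_laplacian] is applied to [y] and to [y - g]. By the transfer relations degree [t + 1] of
    the second sum of squares matches degree [t] of the first, so only degree [n] of the first and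
    degree 0 of the second survive. *)
Lemma certificate_identity :
  sq (y n) - sq (y n - g n) - N / 2 * \sum_(0 <= j < n.+1) \sum_(0 <= k < n.+1)
    pdot (q j) (q k) * (sq (y j - y k) - sq ((y j - g j) - (y k - g k))) =
  2 * dot (y 0%N) (g n) - N * sq (g n).
Proof.
under eq_bigr do under eq_bigr do rewrite mulrBr.
under eq_bigr do rewrite sumrB.
rewrite sumrB mulrBr opprB.
have S0E t : S0`_t = N^-1 * (t < n.+1)%:R by rewrite /S0 bq coefZ coef_ones.
set A' := \sum_(0 <= j < _) _; set A := \sum_(0 <= j < _) _.
have -> : sq (y n) + (- sq (y n - g n)) + (N / 2 * A' - N / 2 * A) =
   (sq (y n) - N / 2 * A) - (sq (y n - g n) - N / 2 * A') by ring.
rewrite -gram_laplacian -(gram_laplacian (fun j => y j - g j)) -mulrBr.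
rewrite big_nat_recr //= [X in _ - X]big_nat_recl //= transfer_coef0.
rewrite [X in _ - (_ + X)](eq_big_nat _ _ (F2 := fun t => sq (\sum_(0 <= j < n.+1) (q j)`_t *: y j))); last first.
  move=> t /andP[_ ltt]; rewrite transfer_coefS !S0E ltnS ltt ltnW //.
  by rewrite subrr scale0r addr0.
(* The transfer relation at [t = n], whose left side vanishes because no [q j] has degree above
   [n]. *)
have -> : \sum_(0 <= j < n.+1) (q j)`_n *: y j = N^-1 *: y 0%N.
  have := transfer_coefS n; rewrite !S0E ltnn ltnSn mulr0 mulr1 sub0r.
  rewrite big1_seq => [/eqP|j /andP[_]]; last first.
    rewrite mem_index_iota => /andP[_ ltj]; rewrite nth_default ?scale0r //.
    by apply: leq_trans (response_size_le qR _) _; lia.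
  by rewrite scaleNr eq_sym subr_eq0 => /eqP.
rewrite S0E /= mulr1 sqB; set P := \sum_(0 <= i < n) _; rewrite /sq !dotE.
by field.
Qed.

End Certificate.

(** * Balance and nonnegative certificates imply optimality *)

Section Sufficiency.
Variables (R : realType) (n : nat) (H : 'M[R]_n).

Lemma generates_entry (X : normedModType R) (T : X -> X) (y : nat -> X) :
  generates H T y <-> forall k, (k < n)%N ->
    y k.+1 = y k - \sum_(0 <= j < k.+1) entry H k j *: (y j - T (y j)).
Proof.
have sumE (k : 'I_n) : \sum_(0 <= j < k.+1) entry H k j *: (y j - T (y j)) =
    \sum_(j < n | (j <= k)%N) H k j *: (y j - T (y j)).
  rewrite (big_nat_widen 0 k.+1 n) ?ltn_ord // big_mkord.
  by apply: eq_bigr => j _; rewrite entryE.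
split=> [gen k ltk|gen k]; first by rewrite (gen (Ordinal ltk)) -sumE.
by rewrite gen // sumE.
Qed.

Hypothesis bH : balanced n (response H).

(** Completing the square: the optimality gap is nonnegative as soon as the last bracket is. *)
Lemma certificate_gap (X : lmodType R) (dot : {dot X for idfun}) (x g : X) :
  4 * dot x x / n.+1%:R ^+ 2 - dot g g =
  dot (2 / n.+1%:R *: x - g) (2 / n.+1%:R *: x - g) +
  2 / n.+1%:R * (2 * dot x g - n.+1%:R * dot g g).
Proof.
have N_neq0 : n.+1%:R != 0 :> R by rewrite pnatr_eq0.
rewrite !dotE (dotC _ g x); move: (n.+1%:R) N_neq0 => N N_neq0.
by field.
Qed.

Lemma Hstar_sufficient : is_trig_mx H ->
  (forall j k, (j < k <= n)%N -> pdot (response H j) (response H k) <= 0) -> Hstar H.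
Proof.
move=> trigH npos; split=> // X dot dotN T ystar y Tnexp Tfix /generates_entry gen.
have nexp x z : 0 <= dot (x - z) (x - z) - dot (T x - T z) (T x - T z).
  by rewrite subr_ge0 !dotN ler_pXn2r ?nnegrE.
pose g j := y j - T (y j).
(* Translation by the fixed point moves it to the origin and changes neither the residuals nor the
   differences. *)
have yE k : (k < n)%N -> y k.+1 - ystar =
    y k - ystar - \sum_(0 <= j < k.+1) entry H k j *: g j.
  by move=> ltk; rewrite gen // addrAC.
have TE j : y j - ystar - g j = T (y j) - ystar by rewrite /g opprB addrC addrA subrK.
have := certificate_identity dot (response_is_response H) bH yE.
rewrite TE => gap.
rewrite -!dotN -subr_ge0 certificate_gap addr_ge0 ?dot_ge0 // mulr_ge0 ?divr_ge0 //.
rewrite -[y n - T (y n)]/(g n) -gap addr_ge0 //; first by rewrite -{3 4}Tfix.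
rewrite -mulrN mulr_ge0 ?divr_ge0 // -sumrN big_mkord.
apply: sumr_ge0 => j _; rewrite -sumrN big_mkord; apply: sumr_ge0 => k _.
rewrite -mulNr !TE.
have subr2 (a b c : X) : a - c - (b - c) = a - b by rewrite opprB addrA subrK.
rewrite !subr2; have [->|nejk] := eqVneq j k; first by rewrite !subrr mulr0.
rewrite mulr_ge0 ?nexp // oppr_ge0; case: (ltngtP j k) => [ltjk|ltkj|/val_inj ejk].
- by rewrite npos // ltjk -ltnS /=.
- by rewrite pdotC npos // ltkj -ltnS /=.
- by rewrite ejk eqxx in nejk.
Qed.

End Sufficiency.

(** * The isometry used as a test operator *)

Section Shift.
Variables (R : realType) (n : nat).
Local Notation E := (euclid R n.+1).

(* The negacyclic shift: an isometry with shift^(n+1) = -1. *)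
Definition shift (x : E) : E :=
  \row_(i < n.+1) if unlift ord0 i is Some k then ecoord x (widen_ord (leqnSn n) k)
                  else - ecoord x ord_max.

Lemma ecoord_shift0 x : ecoord (shift x) ord0 = - ecoord x ord_max.
Proof. by rewrite /ecoord mxE unlift_none. Qed.

Lemma ecoord_shift_lift x k :
  ecoord (shift x) (lift ord0 k) = ecoord x (widen_ord (leqnSn n) k).
Proof. by rewrite {1}/ecoord mxE liftK. Qed.

Lemma euclidP (x z : E) : (forall i, ecoord x i = ecoord z i) -> x = z.
Proof. by move=> e; apply/rowP. Qed.

Fact shift_linear : linear shift.
Proof.
move=> a x z; apply: euclidP => i; rewrite ecoordD ecoordZ.
case: (unliftP ord0 i) => [k ->|->].
  by rewrite !ecoord_shift_lift ecoordD ecoordZ.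
by rewrite !ecoord_shift0 ecoordD ecoordZ opprD mulrN.
Qed.
HB.instance Definition _ := GRing.isLinear.Build R E E _ shift shift_linear.

Lemma edot_shift x z : edot (shift x) (shift z) = edot x z.
Proof.
rewrite /edot big_ord_recl [RHS]big_ord_recr /= !ecoord_shift0 mulrNN addrC.
by congr (_ + _); apply: eq_bigr => k _; rewrite !ecoord_shift_lift.
Qed.

Definition eones : E := const_mx 1.

Lemma ecoord_eones i : ecoord eones i = 1.
Proof. by rewrite /ecoord mxE. Qed.

(** The sign at the wrap-around makes [eones - shift eones] twice the first basis vector, and the
    shift then moves it along the coordinates. *)
Lemma iter_shift_eones t i : (t <= n)%N ->
  ecoord (iter t shift (eones - shift eones)) i = 2 * (i == t :> nat)%:R.
Proof.
elim: t i => [|t IH] i let_.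
  rewrite /= -scaleN1r ecoordD ecoordZ ecoord_eones; case: (unliftP ord0 i) => [k ->|->].
    by rewrite ecoord_shift_lift ecoord_eones /=; ring.
  by rewrite ecoord_shift0 ecoord_eones /=; ring.
rewrite iterS; case: (unliftP ord0 i) => [k ->|->].
  by rewrite ecoord_shift_lift IH 1?ltnW.
by rewrite ecoord_shift0 IH 1?ltnW //= gtn_eqF // mulr0 oppr0.
Qed.

Lemma edot_eones x : edot eones x = \sum_i ecoord x i.
Proof. by apply: eq_bigr => i _; rewrite ecoord_eones mul1r. Qed.

End Shift.

Section Trajectory.
Variables (R : realType) (X : lmodType R) (h : nat -> nat -> R).
Variables (F : nat -> X -> X) (a : X).

Lemma trajectory_exists : exists2 y : nat -> X, y 0%N = a &
  forall k, y k.+1 = y k - \sum_(0 <= j < k.+1) h k j *: F j (y j).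
Proof.
pose step k (z : nat -> X) := z k - \sum_(0 <= j < k.+1) h k j *: F j (z j).
(* [traj k] tabulates the iterates up to index [k], as each step refers to all earlier ones. *)
pose traj := fix traj k : nat -> X := if k is k'.+1
  then fun j => if (j <= k')%N then traj k' j else step k' (traj k') else fun=> a.
have trajE k j : (j <= k)%N -> traj k j = traj j j.
  elim: k => [|k IH]; first by rewrite leqn0 => /eqP->.
  by rewrite leq_eqVlt => /predU1P[->//|]; rewrite ltnS /= => lejk; rewrite lejk IH.
exists (fun k => traj k k) => // k; rewrite [LHS]/= ltnn /step; congr (_ - _).
by apply: eq_big_nat => j /andP[_ lej]; rewrite trajE.
Qed.

End Trajectory.

(** * Optimality implies balance and nonnegative certificates *)

Section Necessity.
Variables (R : realType) (n : nat) (H : 'M[R]_n).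
Hypothesis starH : Hstar H.
Local Notation E := (euclid R n.+1).
Local Notation q := (response H).
Let N : R := n.+1%:R.
Let N_neq0 : N != 0. Proof. by rewrite pnatr_eq0. Qed.
Let N_gt0 : 0 < N. Proof. by rewrite ltr0n. Qed.
Let qR : is_response n (entry H) q := response_is_response H.

Lemma Hstar_euclid (T : E -> E) (y : nat -> E) :
  (forall x z, edot (T x - T z) (T x - T z) <= edot (x - z) (x - z)) -> T 0 = 0 ->
  (forall k, (k < n)%N ->
     y k.+1 = y k - \sum_(0 <= j < k.+1) entry H k j *: (y j - T (y j))) ->
  edot (y n - T (y n)) (y n - T (y n)) <= 4 * edot (y 0%N) (y 0%N) / N ^+ 2.
Proof.
move=> Tnexp T0 gen; have [_ /(_ E (@edot R n.+1 : {dot E for idfun}))] := starH.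
move=> /(_ (@edot_norm _ _) T 0 y) star.
rewrite -[y 0%N]subr0 !edot_norm; apply: star => //; last exact/generates_entry.
by move=> x z; rewrite -(@ler_pXn2r _ 2) ?nnegrE // -!edot_norm.
Qed.

Lemma shift_trajectory : exists2 y : nat -> E, y 0%N = eones R n &
  forall k, y k.+1 = y k - \sum_(0 <= j < k.+1) entry H k j *: (y j - shift (y j)).
Proof. exact: trajectory_exists (fun=> fun x => x - shift x) _. Qed.

Let S0 := \sum_(0 <= j < n.+1) q j.

Section ShiftTrajectory.
Variable y : nat -> E.
Hypothesis y0 : y 0%N = eones R n.
Hypothesis yE : forall k, y k.+1 = y k - \sum_(0 <= j < k.+1) entry H k j *: (y j - shift (y j)).

Let g j := y j - shift (y j).
Let Y t := \sum_(0 <= j < n.+1) (q j)`_t *: y j.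

Let yE' k : (k < n)%N -> y k.+1 = y k - \sum_(0 <= j < k.+1) entry H k j *: g j.
Proof. by move=> _; exact: yE. Qed.

Let shiftY t : shift (Y t) = \sum_(0 <= j < n.+1) (q j)`_t *: (y j - g j).
Proof.
rewrite linear_sum; apply: eq_bigr => j _; by rewrite linearZ /g opprB addrC subrK.
Qed.

Let Y_big t : (n < t)%N -> Y t = 0.
Proof.
move=> ltt; rewrite /Y big1_seq // => j /andP[_]; rewrite mem_index_iota => /andP[_ ltj].
rewrite nth_default ?scale0r //.
by apply: leq_trans (response_size_le qR _) _; lia.
Qed.

Let S0_big t : (n < t)%N -> S0`_t = 0.
Proof.
move=> ltt; rewrite nth_default //.
by apply: leq_trans (response_tail_size_le 0 qR) _; rewrite subn0.
Qed.

Let iter_shiftP m c (x z : E) :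
  iter m (@shift R n) (c *: x + z) = c *: iter m (@shift R n) x + iter m (@shift R n) z.
Proof. by elim: m => //= m ->; rewrite linearP. Qed.

Let iter_shiftB m (x z : E) :
  iter m (@shift R n) (x - z) = iter m (@shift R n) x - iter m (@shift R n) z.
Proof. by rewrite addrC -scaleN1r iter_shiftP scaleN1r addrC. Qed.

(** Iterating the transfer relations expands [g n] in the vectors [shift^t (u - shift u)] with the
    coefficients of [S0]; by [iter_shift_eones] these vectors are [2 e_t]. *)
Lemma shift_residual i : ecoord (g n) i = 2 * S0`_i.
Proof.
pose u := eones R n; pose U m := iter m (@shift R n).
(* The last bracket is the remainder; at [m = n + 1] it is 0, since [S0] and [Y] vanish beyond
   degree [n]. *)
have unroll m : g n = \sum_(0 <= t < m) S0`_t *: U t (u - shift u) +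
    (S0`_m *: U m u - U m.+1 (Y m)).
  elim: m => [|m IH].
    rewrite big_geq // add0r /U /= shiftY (transfer_coef0 qR yE') y0 opprB.
    by rewrite addrC subrK.
  rewrite IH big_nat_recr // -addrA; congr (_ + _).
  have -> : U m.+2 (Y m.+1) = U m.+1 (Y m) + (S0`_m.+1 - S0`_m) *: U m.+1 u.
    rewrite /U iterSr shiftY (transfer_coefS qR yE') y0 addrC.
    by rewrite iter_shiftP addrC.
  have -> : U m (u - shift u) = U m u - U m.+1 u.
    by rewrite /U iter_shiftB -iterSr.
  rewrite scalerBr scalerBl.
  have zid (a b c d : E) : a - d = a - b + (c - (d + (c - b))).
    by apply: euclidP => k; rewrite /ecoord !mxE; ring.
  exact: zid.
have := unroll n.+1; rewrite S0_big // scale0r Y_big // sub0r.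
have -> : U n.+2 0 = 0 by rewrite /U; elim: n.+2 => //= m ->; rewrite linear0.
rewrite oppr0 addr0 => ->; rewrite big_mkord.
have ecoord_sum (F : 'I_n.+1 -> E) : ecoord (\sum_t F t) i = \sum_t ecoord (F t) i.
  by rewrite /ecoord summxE.
rewrite ecoord_sum (bigD1 i) //= big1 ?addr0 => [|t neti].
  by rewrite ecoordZ iter_shift_eones -1?ltnS // eqxx mulr1 mulrC.
have /negPf neti' : i != t :> nat by rewrite eq_sym.
by rewrite ecoordZ iter_shift_eones -1?ltnS // neti' !mulr0.
Qed.

(** The equality case of Cauchy-Schwarz: [<u, g n> = 2] because only [q n] is nonzero at 1,
    [<u, u> = N], and optimality bounds [<g n, g n>] by [4 / N]. *)
Lemma shift_residual_eones : g n = (2 / N) *: eones R n.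
Proof.
pose u := eones R n.
have uu : edot u u = N.
  rewrite edot_eones; under eq_bigr do rewrite ecoord_eones.
  by rewrite sumr_const card_ord.
have ug : edot u (g n) = 2.
  rewrite edot_eones; under eq_bigr do rewrite shift_residual.
  rewrite -mulr_sumr -[RHS]mulr1; congr (_ * _).
  have -> : \sum_(i < n.+1) S0`_i = S0.[1].
    rewrite (@horner_coef_wide _ n.+1); last first.
      by apply: leq_trans (response_tail_size_le 0 qR) _; rewrite subn0.
    by apply: eq_bigr => i _; rewrite expr1n mulr1.
  rewrite horner_sum big_nat_recr //= (qR.1) hornerC big1_seq ?add0r // => j /andP[_].
  by rewrite mem_index_iota => /andP[_ ltj]; apply: (response_root1 qR).
have gg : edot (g n) (g n) <= 4 / N.
  have := @Hstar_euclid (@shift R n) y _ (linear0 _) yE'.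
  rewrite y0 uu; have -> : 4 * N / N ^+ 2 = 4 / N by field.
  by apply => x z; rewrite -linearB edot_shift.
have le0 : edot (g n - (2 / N) *: u) (g n - (2 / N) *: u) <= 0.
  have -> : edot (g n - (2 / N) *: u) (g n - (2 / N) *: u) =
      edot (g n) (g n) - 2 * (2 / N) * edot u (g n) + (2 / N) ^+ 2 * edot u u.
    exact: (dot_distZ (@edot R n.+1)).
  rewrite ug uu; have -> : (2 / N) ^+ 2 * N = 4 / N by field.
  have -> : 2 * (2 / N) * 2 = 2 * (4 / N) by field.
  by move: gg; move: (4 / N) => c gg; lra.
apply/eqP; rewrite -subr_eq0; apply/eqP; apply: (@dot_eq0 _ _ (@edot R n.+1)).
by apply/le_anti; rewrite (dot_ge0 (@edot R n.+1)) andbT.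
Qed.

Lemma shift_balanced : balanced n q.
Proof.
apply/polyP => t; rewrite coefZ coef_ones.
case: ltnP => [ltt|let_]; last by rewrite mulr0 S0_big.
have := congr1 (@ecoord R n.+1 ^~ (Ordinal ltt)) shift_residual_eones.
rewrite shift_residual ecoordZ ecoord_eones mulr1 /= => e.
by apply: (@mulfI _ 2) => //; rewrite mulr1 -/N -e.
Qed.

(* The combinations Y (n - t) are the images of eones under shift^t up to scale,
   and these span E; hence so do the iterates. *)
Lemma shift_trajectory_test (s : nat -> R) :
  exists nu : E, forall k, (k <= n)%N -> edot nu (y k) = s k.
Proof.
pose u := eones R n; pose U m := iter m (@shift R n).
have S0E t : S0`_t = N^-1 * (t < n.+1)%:R by rewrite /S0 shift_balanced coefZ coef_ones.
have shiftYS t : (t < n)%N -> shift (Y t.+1) = Y t.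
  move=> ltt; rewrite shiftY (transfer_coefS qR yE') -/S0 !S0E ltnS ltt leqW // -/(Y t).
  by rewrite subrr scale0r addr0.
have Yn : Y n = N^-1 *: u.
  have := transfer_coefS qR yE' n; rewrite -shiftY -/(Y n) -/S0 Y_big // linear0 y0.
  rewrite !S0E ltnn ltnSn mulr0 mulr1 sub0r scaleNr => /eqP.
  by rewrite eq_sym subr_eq0 => /eqP.
have shiftY0 : shift (Y 0%N) = - (N^-1 *: u).
  rewrite shiftY (transfer_coef0 qR yE') -/S0 S0E mulr1 y0 shift_residual_eones.
  rewrite -scalerBl -[RHS]scaleNr; congr (_ *: _); ring.
have UY m : (m <= n)%N -> U m u = N *: Y (n - m)%N.
  elim: m => [|m IH] ltm; first by rewrite subn0 Yn scalerA divff // scale1r.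
  rewrite /U iterS -/(U m u) IH 1?ltnW // linearZ /=.
  have -> : (n - m = (n - m.+1).+1)%N by lia.
  by rewrite shiftYS //; lia.
(* Injectivity of [v |-> (<v, y k>)_k] on a space of dimension [n + 1] makes the square matrix [M]
   invertible, so the values [s k] can be prescribed. *)
have inj (v : E) : (forall k, (k <= n)%N -> edot v (y k) = 0) -> v = 0.
  move=> orth.
  have orthY t : edot v (Y t) = 0.
    rewrite edot_sumr big1_seq // => j /andP[_].
    rewrite mem_index_iota => /andP[_ ltj].
    by rewrite edotZr orth ?mulr0.
  have orthU m : (m <= n.+1)%N -> edot v (U m u) = 0.
    rewrite leq_eqVlt => /predU1P[->|]; last first.
      by rewrite ltnS => lem; rewrite UY // edotZr orthY mulr0.
    rewrite /U iterS -/(U n u) UY // subnn linearZ /= shiftY0 -Yn.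
    by rewrite edotZr edotNr orthY oppr0 mulr0.
  apply: euclidP => i; rewrite [RHS]mxE.
  have : edot v (U i (u - shift u)) = 0.
    rewrite /U iter_shiftB -iterSr -/(U i u) -/(U i.+1 u) edotBr !orthU ?subrr //.
    by rewrite ltnW.
  rewrite /edot (bigD1 i) //= big1 ?addr0 => [|k nek].
    rewrite iter_shift_eones -1?ltnS // eqxx mulr1 => /eqP.
    by rewrite mulf_eq0 pnatr_eq0 orbF => /eqP.
  have /negPf nek' : k != i :> nat by [].
  by rewrite iter_shift_eones -1?ltnS // nek' !mulr0.
pose M : 'M[R]_n.+1 := \matrix_(i, k) ecoord (y k) i.
have ME (v : 'rV[R]_n.+1) k : (v *m M) 0 k = edot v (y k).
  by rewrite mxE; apply: eq_bigr => i _; rewrite mxE.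
have : row_free M.
  apply: inj_row_free => v vM; apply: inj => k lek.
  by rewrite -[k]/(nat_of_ord (Ordinal (lek : k < n.+1)%N)) -ME vM mxE.
rewrite row_free_unit => Mu.
exists (\row_k s k *m invmx M) => k lek.
by rewrite -[k]/(nat_of_ord (Ordinal (lek : k < n.+1)%N)) -ME mulmxKV // mxE.
Qed.

(* Compose shift with x |-> x - e phi(<nu, x>) nu, where <nu, y k> = s k.  As phi
   is locally constant at each s k, the perturbed trajectory is affine in e, and
   the claim is the first-order term in e of the optimality inequality. *)
Lemma monotone_test (s : nat -> R) (phi : R -> R) :
  (forall a b, a <= b -> 0 <= phi b - phi a <= 3 * (b - a)) -> phi 0 = 0 -> s n = 0 ->
  (forall k r, (k <= n)%N -> `|r - s k| <= 3^-1 -> phi r = phi (s k)) ->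
  \sum_(0 <= j < n.+1) \sum_(0 <= k < n.+1)
    pdot (q j) (q k) * ((phi (s j) - phi (s k)) * (s j - s k)) <= 0.
Proof.
move=> phi_mono phi0 sn flat.
have bq : balanced n q := shift_balanced.
have [nu nuE] := shift_trajectory_test s.
pose psi k := phi (s k).
have [w w0 wE] := trajectory_exists (entry H)
  (fun j x => x - shift x + psi j *: shift nu) (0 : E).
set P := \sum_(0 <= j < _) _.
pose om k := edot nu (w k).
pose Q := \sum_(0 <= j < n.+1) \sum_(0 <= k < n.+1) pdot (q j) (q k) *
  (2 * (psi j - psi k) * (om j - om k) - (psi j - psi k) ^+ 2 * edot nu nu).
pose c := w n - shift (w n) + psi n *: shift nu.
pose K := \sum_(0 <= k < n.+1) `|om k|.
have K_ge0 : 0 <= K by apply: sumr_ge0.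
have nu_ge0 := edot_ge0 nu.
(* The first smallness condition keeps [<nu, ye k>] within [1/3] of [s k], where [phi] is constant;
   the second makes the perturbed operator nonexpansive. [Q] and [c] carry the second-order
   terms. *)
have bound (e : R) : 0 < e -> e * (3 * (K + 1)) <= 1 -> e * (3 * edot nu nu) <= 2 ->
    2 * P <= e * (edot c c - Q).
  move=> e0 eK enu.
  pose T (x : E) := shift (x - (e * phi (edot nu x)) *: nu).
  pose ye k := y k + e *: w k.
  have nuye k : (k <= n)%N -> edot nu (ye k) = s k + e * om k.
    by move=> lek; rewrite edotDr edotZr nuE.
  have Tye k : (k <= n)%N -> T (ye k) = shift (ye k - (e * psi k) *: nu).
    move=> lek; rewrite /T nuye // (flat k) //.
    rewrite addrAC subrr add0r normrM (gtr0_norm e0).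
    have : `|om k| <= K.
      rewrite /K (bigD1_seq k) ?mem_index_iota ?iota_uniq //= lerDl.
      exact: sumr_ge0.
    move=> omK; have : e * `|om k| <= e * (K + 1) by rewrite ler_wpM2l ?ltW //; lra.
    by move: eK; lra.
  have gye k : (k <= n)%N ->
      ye k - T (ye k) = g k + e *: (w k - shift (w k) + psi k *: shift nu).
    move=> lek; rewrite Tye // /ye /g !(linearD, linearB, linearZ, linearN) /=.
    by apply: euclidP => i; rewrite !(ecoordD, ecoordZ, ecoordN); ring.
  have yeE k : (k < n)%N ->
      ye k.+1 = ye k - \sum_(0 <= j < k.+1) entry H k j *: (ye j - T (ye j)).
    move=> ltk; rewrite /ye yE wE scalerBr addrACA -opprD scaler_sumr -big_split.
    congr (_ - _); apply: eq_big_nat => j /andP[_ lej].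
    by rewrite -/(ye j) gye ?scalerDr ?scalerA 1?[e * _]mulrC //; lia.
  have T0 : T 0 = 0 by rewrite /T edot0r phi0 mulr0 scale0r subr0 linear0.
  have Tnexp x z : edot (T x - T z) (T x - T z) <= edot (x - z) (x - z).
    have -> : T x - T z = shift ((x - z) - (e * (phi (edot nu x) - phi (edot nu z))) *: nu).
      by rewrite /T -linearB; congr (shift _); apply: euclidP => i;
        rewrite !(ecoordD, ecoordZ, ecoordN); ring.
    rewrite edot_shift edot_distZ (edotBr x z nu).
    set a := edot nu x; set b := edot nu z.
    suff : 0 <= e * (phi a - phi b) * (2 * (a - b) - e * (phi a - phi b) * edot nu nu) by lra.
    have key a' b' : a' <= b' ->
        0 <= e * (phi b' - phi a') * (2 * (b' - a') - e * (phi b' - phi a') * edot nu nu).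
      move=> leab; have /andP[D0 D3] := phi_mono _ _ leab.
      apply: mulr_ge0; first by apply: mulr_ge0 => //; exact: ltW.
      rewrite subr_ge0.
      have le1 : e * (phi b' - phi a') * edot nu nu <= e * (3 * (b' - a')) * edot nu nu.
        by rewrite ler_wpM2r // ler_wpM2l // ltW.
      apply: le_trans le1 _; have ba0 : 0 <= b' - a' by rewrite subr_ge0.
      have := ler_wpM2r ba0 enu; lra.
    case: (leP a b) => [leab|/ltW leba]; last exact: key.
    by have := key _ _ leab; lra.
  have := Hstar_euclid Tnexp T0 yeE; rewrite -subr_ge0.
  pose ge k := ye k - T (ye k).
  have -> : 4 * edot (ye 0%N) (ye 0%N) / N ^+ 2 - edot (ye n - T (ye n)) (ye n - T (ye n)) =
    edot (2 / N *: ye 0%N - ge n) (2 / N *: ye 0%N - ge n) +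
    2 / N * (2 * edot (ye 0%N) (ge n) - N * edot (ge n) (ge n)).
    exact: (certificate_gap n (@edot R n.+1)).
  have -> : 2 * edot (ye 0%N) (ge n) - N * edot (ge n) (ge n) =
      edot (ye n) (ye n) - edot (ye n - ge n) (ye n - ge n) - N / 2 *
      \sum_(0 <= j < n.+1) \sum_(0 <= k < n.+1) pdot (q j) (q k) *
        (edot (ye j - ye k) (ye j - ye k) -
         edot ((ye j - ge j) - (ye k - ge k)) ((ye j - ge j) - (ye k - ge k))).
    by symmetry; exact: (certificate_identity (@edot R n.+1) qR bq yeE).
  have geT k : ye k - ge k = T (ye k) by rewrite /ge opprB addrC subrK.
  have psin : psi n = 0 by rewrite /psi sn.
  have -> : edot (ye n) (ye n) - edot (ye n - ge n) (ye n - ge n) = 0.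
    by rewrite geT Tye // psin mulr0 scale0r subr0 edot_shift subrr.
  have -> : edot (2 / N *: ye 0%N - ge n) (2 / N *: ye 0%N - ge n) = e ^+ 2 * edot c c.
    have -> : 2 / N *: ye 0%N - ge n = - e *: c.
      rewrite /ge gye // shift_residual_eones /ye y0 w0 -/c scaler0 addr0.
      by rewrite opprD addrA subrr add0r scaleNr.
    by rewrite edotZr edotC edotZr; ring.
  have -> : \sum_(0 <= j < n.+1) \sum_(0 <= k < n.+1) pdot (q j) (q k) *
        (edot (ye j - ye k) (ye j - ye k) -
         edot ((ye j - ge j) - (ye k - ge k)) ((ye j - ge j) - (ye k - ge k))) =
      e * (2 * P) + e ^+ 2 * Q.
    rewrite /P /Q !mulr_sumr -big_split; apply: eq_big_nat => j /andP[_ ltj].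
    rewrite !mulr_sumr -big_split; apply: eq_big_nat => k /andP[_ ltk].
    rewrite !geT !Tye // -linearB edot_shift.
    have -> : ye j - (e * psi j) *: nu - (ye k - (e * psi k) *: nu) =
        ye j - ye k - (e * (psi j - psi k)) *: nu.
      by apply: euclidP => i; rewrite !(ecoordD, ecoordZ, ecoordN); ring.
    by rewrite edot_distZ (edotBr _ _ nu) !nuye // /psi /=; ring.
  have -> : e ^+ 2 * edot c c + 2 / N * (0 - N / 2 * (e * (2 * P) + e ^+ 2 * Q)) =
      e * (e * (edot c c - Q) - 2 * P) by field.
  by rewrite pmulr_rge0 // subr_ge0.
(* Letting [e] tend to 0, in explicit form. *)
have small (e1 : R) : 0 < e1 -> (forall e, 0 < e -> e <= e1 -> 2 * P <= e * (edot c c - Q)) -> P <= 0.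
  move=> e1_gt0 small; rewrite leNgt; apply/negP => P0.
  set C := edot c c - Q in small.
  have C1 : 0 < 1 + `|C| by rewrite ltr_pwDl.
  pose e := Num.min e1 (P / (1 + `|C|)).
  have e_gt0 : 0 < e by rewrite lt_min e1_gt0 divr_gt0.
  have := small e e_gt0; rewrite ge_min lexx => /(_ isT).
  have eC : e * C <= P.
    apply: le_trans (_ : e * (1 + `|C|) <= P).
      by rewrite ler_wpM2l ?ltW // ltr_pwDl ?ler_norm.
    by rewrite -ler_pdivlMr // ge_min lexx orbT.
  lra.
pose b1 := 3 * (K + 1); pose b2 := 3 * edot nu nu.
have b12 : 0 < b1 + b2 by rewrite /b1 /b2; lra.
apply: (small (b1 + b2)^-1); first by rewrite invr_gt0.
move=> e e0 ele; have : e * (b1 + b2) <= 1 by rewrite -ler_pdivlMr // mul1r.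
rewrite mulrDr => le1; have eb1 : 0 <= e * b1 by rewrite mulr_ge0 ?ltW // /b1; lra.
have eb2 : 0 <= e * b2 by rewrite mulr_ge0 ?(ltW e0) // /b2; lra.
by apply: bound => //; rewrite -/b1 -/b2; lra.
Qed.

End ShiftTrajectory.

Lemma Hstar_balanced : balanced n q.
Proof. by have [y y0 yE] := shift_trajectory; exact: shift_balanced y0 yE. Qed.

(** Constant within [1/3] of the levels 0 and 1 and of slope 3 in between, matching the constants of
    [monotone_test]. *)
Let ramp (x : R) : R := Num.max 0 (Num.min 1 (3 * x - 1)).

Let ramp_mono a b : a <= b -> 0 <= ramp b - ramp a <= 3 * (b - a).
Proof.
move=> leab; rewrite /ramp !maxEle !minEle.
by do 4!case: ifP => /idP; move=> *; apply/andP; split; lra.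
Qed.

Let ramp_low x : x <= 3^-1 -> ramp x = 0.
Proof. by move=> le3; rewrite /ramp max_l // ge_min; apply/orP; right; lra. Qed.

Let ramp_high x : 2 / 3 <= x -> ramp x = 1.
Proof. by move=> le3; rewrite /ramp min_l ?max_r //; lra. Qed.

(* Test direction: node k0 at level 1, node j0 at level -M and all others at level
   0, with a ramp between levels 0 and 1; then M tends to infinity. *)
Lemma Hstar_pdot_le0 j0 k0 : (j0 < k0 <= n)%N -> pdot (q j0) (q k0) <= 0.
Proof.
move=> /andP[ltjk lekn]; have [y y0 yE] := shift_trajectory.
have lejn : (j0 <= n)%N by lia.
have row (M : R) : 0 <= M ->
    \sum_(0 <= k < n.+1) pdot (q k0) (q k) * (1 - (k == k0)%:R) + M * pdot (q j0) (q k0) <= 0.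
  move=> M_ge0.
  pose sh k : R := (k == k0)%:R - M * (k == j0)%:R.
  (* Recentring at node [n] gives [s n = 0] and [phi 0 = 0]; differences are unaffected. *)
  pose c := sh n; pose phi r := ramp (r + c) - ramp c.
  have phiE k r : `|r - (sh k - c)| <= 3^-1 -> phi r = (k == k0)%:R - ramp c.
    rewrite ler_norml => /andP[ge le]; congr (_ - _).
    move: ge le; rewrite /sh; case: (eqVneq k k0) => [->|nek0].
      by rewrite gtn_eqF //= mulr1n mulr0n mulr0 => *; rewrite ramp_high //; lra.
    rewrite mulr0n; have : 0 <= M * (k == j0)%:R by rewrite mulr_ge0.
    by move=> *; rewrite ramp_low //; lra.
  have phis k : phi (sh k - c) = (k == k0)%:R - ramp c.
    by apply: phiE; rewrite subrr normr0; lra.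
  have := @monotone_test y y0 yE (fun k => sh k - c) phi.
  have mono a b : a <= b -> 0 <= phi b - phi a <= 3 * (b - a).
    move=> leab; have := @ramp_mono (a + c) (b + c); rewrite lerD2r => /(_ leab).
    by rewrite /phi => /andP[*]; apply/andP; split; lra.
  move=> /(_ mono); rewrite {1}/phi add0r !subrr => /(_ erefl erefl).
  have flat k r : (k <= n)%N -> `|r - (sh k - c)| <= 3^-1 -> phi r = phi (sh k - c).
    by move=> _ /phiE ->; rewrite phis.
  move=> /(_ flat).
  pose A := \sum_(0 <= j < n.+1) \sum_(0 <= k < n.+1)
    pdot (q j) (q k) * ((j == k0)%:R * (sh j - sh k)).
  have -> : \sum_(0 <= j < n.+1) \sum_(0 <= k < n.+1) pdot (q j) (q k) *
      ((phi (sh j - c) - phi (sh k - c)) * (sh j - c - (sh k - c))) = A + A.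
    have A' : \sum_(0 <= j < n.+1) \sum_(0 <= k < n.+1)
        pdot (q j) (q k) * ((k == k0)%:R * (sh k - sh j)) = A.
      rewrite /A exchange_big_nat; apply: eq_bigr => j _; apply: eq_bigr => k _.
      by rewrite pdotC.
    rewrite -{2}A' /A -big_split; apply: eq_bigr => j _.
    by rewrite -big_split; apply: eq_bigr => k _; rewrite !phis /=; ring.
  have -> : A = \sum_(0 <= k < n.+1) pdot (q k0) (q k) * (sh k0 - sh k).
    rewrite /A (bigD1_seq k0) ?mem_index_iota ?iota_uniq //= eqxx.
    rewrite [X in _ + X]big1 ?addr0 => [|j /negPf->].
      by apply: eq_bigr => k _; rewrite mul1r.
    by rewrite big1 // => k _; rewrite mul0r mulr0.
  have -> : \sum_(0 <= k < n.+1) pdot (q k0) (q k) * (sh k0 - sh k) =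
     \sum_(0 <= k < n.+1) pdot (q k0) (q k) * (1 - (k == k0)%:R) + M * pdot (q j0) (q k0).
    have -> : M * pdot (q j0) (q k0) =
        \sum_(0 <= k < n.+1) pdot (q k0) (q k) * (M * (k == j0)%:R).
      rewrite (bigD1_seq j0) ?mem_index_iota ?iota_uniq //= eqxx mulr1.
      rewrite big1 ?addr0 => [|k /negPf->]; last by rewrite !mulr0.
      by rewrite pdotC mulrC.
    rewrite -big_split; apply: eq_bigr => k _.
    by rewrite /sh eqxx gtn_eqF //=; ring.
  lra.
rewrite leNgt; apply/negP => d_gt0.
set B := \sum_(0 <= k < n.+1) _ in row.
(* For this [M] the inequality [row] reads [B + |B| + 1 <= 0], which is absurd. *)
have M_ge0 : 0 <= (`|B| + 1) / pdot (q j0) (q k0).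
  by apply: divr_ge0; [rewrite addr_ge0 | exact: ltW].
have := row _ M_ge0; rewrite divfK ?gt_eqF //.
have := ler_norm (- B); rewrite normrN; lra.
Qed.

End Necessity.
(** * Vertices and their duals *)

Section Realization.
Variable R : realType.

(** Equality across types: the sizes [n1 + n2.+1] and [n2 + n1.+1] agree only up to a proof. *)
Definition same_entries n n' (H : 'M[R]_n) (H' : 'M[R]_n') : Prop :=
  n = n' /\ forall i j, (i < n)%N -> (j < n)%N -> entry H i j = entry H' i j.

Lemma same_entries_sym n n' (H : 'M[R]_n) (H' : 'M[R]_n') :
  same_entries H H' -> same_entries H' H.
Proof. by move=> [en eH]; split=> // i j lti ltj; rewrite eH ?en. Qed.

Lemma same_entries_ind (P : forall n, 'M[R]_n -> Prop) n n' (H : 'M[R]_n) (H' : 'M[R]_n') :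
  same_entries H H' -> P n H -> P n' H'.
Proof.
move=> [en eH] PH; case: n' / en H' eH => H' eH.
suff -> : H' = H by [].
by apply/matrixP => i j; rewrite -!entryE eH.
Qed.

Lemma entry_trig n (H : 'M[R]_n) i j : is_trig_mx H -> (i < j)%N -> entry H i j = 0.
Proof.
move=> /is_trig_mxP trig ltij; rewrite /entry; case: insubP => // k _ ek.
by case: insubP => // l _ el; rewrite trig // ek el.
Qed.

Lemma trig_entry n (H : 'M[R]_n) :
  (forall i j, (i < j)%N -> entry H i j = 0) -> is_trig_mx H.
Proof. by move=> e0; apply/is_trig_mxP => i j ltij; rewrite -entryE e0. Qed.

Lemma entry_mx n (h : nat -> nat -> R) i j : (i < n)%N -> (j < n)%N ->
  entry (\matrix_(i < n, j < n) h i j) i j = h i j.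
Proof. by move=> lti ltj; rewrite (entryE _ (Ordinal lti) (Ordinal ltj)) mxE. Qed.

Lemma entry_out n (H : 'M[R]_n) i j : (n <= i)%N || (n <= j)%N -> entry H i j = 0.
Proof.
rewrite /entry => /orP[le|le]; first by rewrite insubF // ltnNge le.
by case: insubP => // k _ _; rewrite insubF // ltnNge le.
Qed.

Lemma entry_Hdual n (H : 'M[R]_n) i j : (i < n)%N -> (j < n)%N ->
  entry (Hdual H) i j = entry H (n - j.+1) (n - i.+1).
Proof.
by move=> lti ltj; rewrite (entryE _ (Ordinal lti) (Ordinal ltj)) mxE -entryE.
Qed.

(** For basic [G] this amounts to [H] being a vertex with diagram [G], stated without quantifying
    over Hilbert spaces. *)
Definition realizes n (H : 'M[R]_n) (G : seq nat) : Prop :=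
  [/\ size G = n, is_trig_mx H, balanced n (response H) & arc_pattern n (response H) G].

Lemma certificate_gt0 n (H : 'M[R]_n) j k : (j < k <= n)%N ->
  (0 < certificate H k.+1 j.+1) = (pdot (response H j) (response H k) < 0).
Proof.
move=> /andP[ltjk lekn]; rewrite certificateE ?(leq_trans ltjk) //.
by rewrite oppr_gt0 pmulr_rlt0.
Qed.

Lemma diagram_of_nth n (H : 'M[R]_n) j k : (j < n)%N -> (j.+1 < k <= n.+1)%N ->
  (forall l, (j.+1 < l <= n.+1)%N -> (0 < certificate H l j.+1) = (l == k)) ->
  nth 0%N (diagram_of H) j = k.
Proof.
move=> ltjn hk pos; rewrite (nth_map 0%N) ?size_iota // nth_iota // add1n.
rewrite (@eq_in_filter _ _ (pred1 k)) => [|l]; last first.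
  by rewrite mem_iota => hl; apply: pos; lia.
by rewrite filter_pred1_uniq ?iota_uniq // mem_iota; lia.
Qed.

Lemma size_diagram_of n (H : 'M[R]_n) : size (diagram_of H) = n.
Proof. by rewrite size_map size_iota. Qed.

Lemma realizes_diagram n (H : 'M[R]_n) G : basic G -> realizes H G -> diagram_of H = G.
Proof.
move=> bG [sz _ _ pat]; apply: (@eq_from_nth _ 0%N); first by rewrite size_diagram_of.
rewrite size_diagram_of => j ltj; have := @basic_arcs G j bG; rewrite sz => /(_ ltj) hk.
apply: diagram_of_nth => // -[//|l] hl; rewrite certificate_gt0; last by lia.
have := pat j l; rewrite eq_sym => /(_ _); case: ifP => _; first by apply; lia.
by move=> ->; rewrite ?ltxx //; lia.
Qed.

Lemma realizes_vertex n (H : 'M[R]_n) G : basic G -> realizes H G -> vertex H.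
Proof.
move=> bG [sz trig bH pat]; split.
  apply: Hstar_sufficient => // j k /pat.
  by case: ifP => _; [exact: ltW | move->].
case=> [//|j] ltj; have := @basic_arcs G j bG; rewrite sz => /(_ ltj) hk.
have pos l : (j.+1 < l <= n.+1)%N -> (0 < certificate H l j.+1) = (l == nth 0%N G j).
  case: l => // l hl; rewrite certificate_gt0; last by lia.
  have := pat j l; rewrite eq_sym => /(_ _); case: ifP => _; first by apply; lia.
  by move=> ->; rewrite ?ltxx //; lia.
exists (nth 0%N G j); split; first by rewrite pos ?eqxx.
by move=> l [hl]; rewrite pos // => /eqP.
Qed.

(** Optimality gives balance and nonpositive Gram entries; uniqueness of [k(j)] forces the entries
    off the arcs to be exactly 0. *)
Lemma vertex_realizes n (H : 'M[R]_n) : vertex H -> realizes H (diagram_of H).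
Proof.
move=> [starH uni]; have [trig _] := starH.
split=> //; [exact: size_diagram_of | exact: Hstar_balanced |].
move=> j k hjk; have [|k0 [[hk0 pk0] k0uni]] := uni j.+1; first by lia.
rewrite (@diagram_of_nth _ _ _ k0) //; [|lia|]; last first.
  move=> l hl; apply/idP/eqP => [pl|->//].
  by symmetry; apply: k0uni.
case: eqVneq => [ek|nek]; first by rewrite -certificate_gt0 // -ek.
apply/le_anti; rewrite Hstar_pdot_le0 //= leNgt -certificate_gt0 //.
apply/negP => pk; case/negP: nek; apply/eqP; apply: k0uni; split=> //; lia.
Qed.

Lemma arc_pattern_zero n (q : nat -> {poly R}) G : arc_pattern n q G -> zero_pattern n q G.
Proof. by move=> pat j k /pat; case: eqP. Qed.

Lemma realizes_unique n n' (H : 'M[R]_n) (H' : 'M[R]_n') G : basic G ->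
  realizes H G -> realizes H' G -> same_entries H H'.
Proof.
move=> bG [sz trig bH pat] [sz' trig' bH' pat']; split; first by rewrite -sz.
subst n'; subst n; move=> i j lti ltj.
case: (leqP j i) => [leji|ltij]; last by rewrite !entry_trig.
apply: (response_entry_unique (response_is_response H) (response_is_response H') bH).
  apply: (response_family_unique bG) => //; [|exact: arc_pattern_zero| |exact: arc_pattern_zero].
  - exact: response_is_family (response_is_response H) bH.
  - exact: response_is_family (response_is_response H') bH'.
by rewrite leji.
Qed.

Lemma is_response_ext n (h h' : nat -> nat -> R) q :
  (forall i j, (i < n)%N -> (j < n)%N -> h i j = h' i j) ->
  is_response n h q -> is_response n h' q.
Proof.
move=> hh' [qn qE]; split=> // j ltj; rewrite qE //; congr (_ * _).
by apply: eq_big_nat => i /andP[_ lti]; rewrite hh'.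
Qed.

Definition Hglue n1 n2 (H1 : 'M[R]_n1) (H2 : 'M[R]_n2) : 'M[R]_(n1 + n2.+1) :=
  \matrix_(i, j) hglue n1 n2 (entry H1) (entry H2) i j.

Lemma hglue_trig n1 n2 (h1 h2 : nat -> nat -> R) i j :
  (forall i j, (i < j)%N -> h1 i j = 0) -> (forall i j, (i < j)%N -> h2 i j = 0) ->
  (i < j)%N -> hglue n1 n2 h1 h2 i j = 0.
Proof.
move=> trig1 trig2 ltij; rewrite /hglue.
case: ltngtP => hi; case: ltngtP => hj //; try lia; first exact: trig1.
by apply: trig2; lia.
Qed.

(** The recursion has one solution, so the response family of the block matrix is [qglue], whose
    balance and pattern are known. *)
Lemma realizes_Hglue n1 n2 (H1 : 'M[R]_n1) (H2 : 'M[R]_n2) G1 G2 :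
  basic G1 -> realizes H1 G1 -> realizes H2 G2 -> realizes (Hglue H1 H2) (gluing G1 G2).
Proof.
move=> bG1 [sz1 trig1 bH1 pat1] [sz2 trig2 bH2 pat2].
have t1 i j : (i < j)%N -> entry H1 i j = 0 by exact: entry_trig.
have t2 i j : (i < j)%N -> entry H2 i j = 0 by exact: entry_trig.
have qR1 := response_is_response H1; have qR2 := response_is_response H2.
have qE : forall j, (j <= n1 + n2.+1)%N ->
    response (Hglue H1 H2) j = qglue n1 n2 (response H1) (response H2) j.
  apply: response_unique (response_is_response _) _.
  apply: is_response_ext (qglue_response qR1 qR2 bH2 t1 t2) => i j lti ltj.
  by rewrite entry_mx.
have rg1 j : (j < n1)%N -> (nth 0%N G1 j <= n1.+1)%N.
  by move=> ltj; have := @basic_arcs G1 j bG1; rewrite sz1 => /(_ ltj)/andP[].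
split.
- by rewrite size_gluing sz1 sz2.
- apply: trig_entry => i j ltij.
  case: (leqP (n1 + n2.+1) j) => [lej|ltj]; first by rewrite entry_out // lej orbT.
  by rewrite entry_mx ?(ltn_trans ltij) // hglue_trig.
- rewrite /balanced; under eq_big_nat => j /andP[_ ltj] do rewrite qE -1?ltnS //.
  exact: (qglue_balanced qR1 bH1 bH2).
- move=> j k hjk; rewrite !qE; [|lia|lia].
  exact: (qglue_pattern qR1 qR2 sz1 sz2 rg1 pat1 pat2).
Qed.

Lemma realizer_exists G : basic G -> exists H : 'M[R]_(size G), realizes H G.
Proof.
elim=> [|G1 G2 bG1 [H1 r1] bG2 [H2 r2]].
  exists 0; split=> //; first by apply/is_trig_mxP; case.
    rewrite /balanced big_nat1 /response eqxx invr1 scale1r /ones big_ord1 //.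
  by move=> j k /= hjk; exfalso; lia.
rewrite size_gluing; exists (Hglue H1 H2).
exact: realizes_Hglue.
Qed.

Lemma vertex_of_realizes G : basic G -> realizes (vertex_of R G) G.
Proof.
move=> bG; have [H rH] := realizer_exists bG.
have [vH dH] : vertex (vertex_of R G) /\ diagram_of (vertex_of R G) = G.
  apply: (@xgetPex _ 0 [set H : 'M[R]_(size G) | vertex H /\ diagram_of H = G]%classic).
  by exists H; split; [exact: realizes_vertex rH | exact: realizes_diagram rH].
by have := vertex_realizes vH; rewrite dH.
Qed.

(** * The H-dual of a gluing *)

Lemma same_entries_Hdual n n' (H : 'M[R]_n) (H' : 'M[R]_n') :
  same_entries H H' -> same_entries (Hdual H) (Hdual H').
Proof. by move/(same_entries_ind (P := fun n' H' => same_entries (Hdual H) (Hdual H'))); apply. Qed.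

Lemma same_entries_diagram n n' (H : 'M[R]_n) (H' : 'M[R]_n') :
  same_entries H H' -> diagram_of H = diagram_of H'.
Proof. by move/(same_entries_ind (P := fun n' H' => diagram_of H = diagram_of H')); apply. Qed.

Lemma same_entries_realizes n n' (H : 'M[R]_n) (H' : 'M[R]_n') G :
  same_entries H H' -> realizes H G -> realizes H' G.
Proof. exact: (same_entries_ind (P := fun n H => realizes H G)). Qed.

Lemma sum_entry_Hdual_row n (H : 'M[R]_n) i : (i < n)%N ->
  \sum_(0 <= k < n) entry (Hdual H) i k = \sum_(0 <= k < n) entry H k (n - i.+1).
Proof.
move=> lti; rewrite big_nat_rev /= add0n; apply: eq_big_nat => k /andP[_ ltk].
by rewrite entry_Hdual //; [congr (entry H _ _) | ]; lia.
Qed.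

Lemma sum_entry_Hdual_col n (H : 'M[R]_n) j : (j < n)%N ->
  \sum_(0 <= k < n) entry (Hdual H) k j = \sum_(0 <= k < n) entry H (n - j.+1) k.
Proof.
move=> ltj; rewrite big_nat_rev /= add0n; apply: eq_big_nat => k /andP[_ ltk].
by rewrite entry_Hdual //; [congr (entry H _ _) | ]; lia.
Qed.

(** The anti-diagonal transpose reverses the order of the blocks and exchanges the column sums of
    row [n1] with the row sums of column [n1]; the corner [N1 N2 / N] is symmetric. *)
Lemma Hdual_Hglue n1 n2 (H1 : 'M[R]_n1) (H2 : 'M[R]_n2) :
  same_entries (Hdual (Hglue H1 H2)) (Hglue (Hdual H2) (Hdual H1)).
Proof.
split=> [|i j lti ltj]; first by rewrite addnC addSnnS.
rewrite entry_Hdual // !entry_mx; try lia.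
rewrite /hglue [n2.+1%:R + _]addrC.
case: (ltngtP i n2) => hi; case: (ltngtP j n2) => hj.
- do !(rewrite ifF; last by lia).
  by rewrite entry_Hdual //; congr (entry H2 _ _); lia.
- rewrite ifT; last by lia.
  by rewrite ifF; last by lia.
- by rewrite ifF; [rewrite ifT; [do !(rewrite ifF; last by lia) | lia] | lia].
- do 2!(rewrite ifF; last by lia).
  by rewrite ifT; last by lia.
- do 2!(rewrite ifT; last by lia).
  by rewrite entry_Hdual; [congr (entry H1 _ _); lia | lia | lia].
- rewrite ifF; last by lia.
  do 2!(rewrite ifT; last by lia).
  rewrite sum_entry_Hdual_row; last by lia.
  by congr (_ * _); apply: eq_bigr => k _; congr (entry H1 _ _); lia.
- do 3!(rewrite ifF; last by lia).
  rewrite ifT; last by lia.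
  by rewrite sum_entry_Hdual_col //; congr (_ * _); apply: eq_bigr => k _; congr (entry H2 _ _); lia.
- rewrite ifT; last by lia.
  by rewrite ifF; last by lia.
- rewrite ifF; last by lia.
  rewrite ifT; last by lia.
  rewrite ifF; last by lia.
  by rewrite ifT; [rewrite [n1.+1%:R * _]mulrC | lia].
Qed.

(** Induction on the gluing: by uniqueness [H] is the block matrix of realizers of the two parts,
    and its dual is the block matrix of their duals. *)
Lemma Hdual_realizes n (H : 'M[R]_n) G : basic G -> realizes H G ->
  exists2 G', basic G' & realizes (Hdual H) G'.
Proof.
move=> bG; elim: bG n H => [|G1 G2 bG1 IH1 bG2 IH2] n H rH.
  exists [::]; first exact: basic_single.
  have [sz _ _ _] := rH; subst n.
  by have -> : Hdual H = H by rewrite [LHS]flatmx0 [RHS]flatmx0.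
have [H1 r1] := realizer_exists bG1; have [H2 r2] := realizer_exists bG2.
have [G1' bG1' r1'] := IH1 _ _ r1; have [G2' bG2' r2'] := IH2 _ _ r2.
exists (gluing G2' G1'); first exact: basic_gluing.
have bG := basic_gluing bG1 bG2.
apply: same_entries_realizes (realizes_Hglue bG2' r2' r1').
apply: same_entries_sym; apply: (same_entries_ind (P := fun n H => same_entries (Hdual H) _)) (Hdual_Hglue H1 H2).
exact: realizes_unique bG (realizes_Hglue bG1 r1 r2) rH.
Qed.

(** [N'] can only be the gluing node: the arc of a smaller node ends inside the first component, and
    for a larger [N'] the arc added by the gluing leaves the nodes [1..N']. *)
Lemma basic_decomposable G N' : basic G -> decomposable_at G N' -> (1 <= N' <= size G)%N ->
  exists G1 G2, [/\ basic G1, basic G2, G = gluing G1 G2 & N' = (size G1).+1].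
Proof.
case=> [|G1 G2 bG1 bG2] [end_ inner] hN'; first by move: hN' => /=; lia.
exists G1, G2; split=> //; move: end_ inner; rewrite /arc_end.
case: N' hN' => [|m] //=; rewrite size_gluing => hm endm inner.
case: (ltngtP m (size G1)) => [ltm|gtm|->//].
  rewrite nth_gluing_low // in endm.
  by have := basic_arcs bG1 ltm; lia.
have := inner (size G1).+1; rewrite /= nth_gluing_mid; lia.
Qed.

Lemma left_part_gluing G1 G2 : left_part (gluing G1 G2) (size G1).+1 = G1.
Proof. by rewrite /left_part /gluing take_size_cat. Qed.

Lemma right_part_gluing G1 G2 : right_part (gluing G1 G2) (size G1).+1 = G2.
Proof.
rewrite /right_part /gluing -cat_rcons drop_size_cat ?size_rcons //.
by rewrite -map_comp -[RHS]map_id; apply: eq_map => k /=; rewrite addKn.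
Qed.

Lemma dual_diagram_gluing G1 G2 : basic G1 -> basic G2 ->
  dual_diagram R (gluing G1 G2) = gluing (dual_diagram R G2) (dual_diagram R G1).
Proof.
move=> bG1 bG2; have bG := basic_gluing bG1 bG2.
have r1 := vertex_of_realizes bG1; have r2 := vertex_of_realizes bG2.
have [G1' bG1' r1'] := Hdual_realizes bG1 r1.
have [G2' bG2' r2'] := Hdual_realizes bG2 r2.
(* [G1'] and [G2'] are known only to exist; [realizes_diagram] identifies them with the dual
   diagrams, after which uniqueness of the vertex reduces the goal to [Hdual_Hglue]. *)
rewrite /dual_diagram (realizes_diagram bG1' r1') (realizes_diagram bG2' r2').
rewrite -(realizes_diagram (basic_gluing bG2' bG1') (realizes_Hglue bG2' r2' r1')).
rewrite -(same_entries_diagram (Hdual_Hglue _ _)).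
apply/same_entries_diagram/same_entries_Hdual.
exact: realizes_unique bG (vertex_of_realizes bG) (realizes_Hglue bG1 r1 r2).
Qed.

End Realization.

Theorem corollary4 (R : realType) (N N' : nat) (G : seq nat) :
  arc_diagram N G -> basic G ->
  (1 <= N' <= N - 1)%N -> decomposable_at G N' ->
  dual_diagram R G =
    gluing (dual_diagram R (right_part G N')) (dual_diagram R (left_part G N')).
Proof.
move=> [-> _] bG hN' dec; rewrite subn1 in hN'.
have [G1 [G2 [bG1 bG2 -> ->]]] := basic_decomposable bG dec hN'.
by rewrite left_part_gluing right_part_gluing dual_diagram_gluing.
Qed.
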